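(* Let $\mu\in\mathcal{M}_{\sigma}(I^{\mathbb{N}})$ with $h_{\mu}<\infty$. Then for every $\mathbf a\in\mathbf Q^{I}$ and for $\mu$-almost every $\mathtt i\in I^{\mathbb N}$ such that $\Lambda_\mu(s,\mathtt i)>-\infty$ for some $s>\dim_{LY}(\mu,\mathtt i)$, we have $$\overline{\dim}_{\mathrm{loc}}(\pi_{\mathbf a}\mu,\pi_{\mathbf a}(\mathtt i))\le\min\{d,\dim_{LY}(\mu,\mathtt i)\}.$$
   Context: Let $I$ be a finite or countably infinite set, $I^{\mathbb{N}}$ the space of infinite sequences $\mathtt{i}=(i_1,i_2,\ldots)$ with the product of discrete topologies and its Borel $\sigma$-algebra. Write $\mathtt{i}|_n=(i_1,\ldots,i_n)$, $[j_1\ldots j_n]=\{\mathtt{i}: \mathtt{i}|_n=(j_1,\dots,j_n)\}$ (cylinder), and $\sigma$ the left shift. $\mathcal{M}_\sigma(I^{\mathbb N})$ denotes the $\sigma$-invariant Borel probability measures. Fix $d\ge1$; for each $i\in I$ fix an invertible real $d\times d$ matrix $A_i$, with $\sup_{i\in I}\|A_i\|<1$. Let $\mathbf{Q}=[-\frac12,\frac12]^d$; for $\mathbf a=(a_i)_{i\in I}\in\mathbf Q^{I}$ put $f_i(x)=A_ix+a_i$, $f_{\mathtt i|_n}=f_{i_1}\circ\cdots\circ f_{i_n}$, and $\{\pi_{\mathbf a}(\mathtt i)\}=\bigcap_n f_{\mathtt i|_n}(B(0,R))$, where $f_i(B(0,R))\subset B(0,R)$ for all $i$. $\pi_{\mathbf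 a}\mu=\mu\circ\pi_{\mathbf a}^{-1}$. For a finite word $\mathtt j=(j_1,\dots,j_n)$, $\alpha_1(\mathtt j)\ge\dots\ge\alpha_d(\mathtt j)>0$ are the singular values of $A_{j_1}\cdots A_{j_n}$; $\phi^s(\mathtt j)=\alpha_1(\mathtt j)\cdots\alpha_k(\mathtt j)\alpha_{k+1}(\mathtt j)^{s-k}$ for $0\le s<d$, $k=\lfloor s\rfloor$, and $\phi^s(\mathtt j)=(\alpha_1(\mathtt j)\cdots\alpha_d(\mathtt j))^{s/d}$ for $s\ge d$. The upper local dimension of $\nu$ at $x$ is $\limsup_{r\to0}\log\nu(B(x,r))/\log r$. Entropy $h_\mu=\lim_n\frac1n H(\mathcal P_n)$ with $H(\mathcal P_n)=-\sum_{\mathtt j\in I^n}\mu[\mathtt j]\log\mu[\mathtt j]$. When $h_\mu<\infty$, for $\mu$-a.e. $\mathtt i$ the limits $h_\mu(\mathtt i)=-\lim_n\frac1n\log\mu[\mathtt i|_n]<\infty$, $\Lambda_\mu(s,\mathtt i)=\lim_n\frac1n\log\phi^s(\mathtt i|_n)$ (all $s\ge0$) and $\lambda_l(\mu,\mathtt i)=\lim_n\frac1n\log\alpha_l(\mathtt i|_n)$ exist; $P_\mu(s,\mathtt i)=h_\mu(\mathtt i)+\Lambda_\mu(s,\mathtt i)$, and $\dim_{LY}(\mu,\mathtt i)=\inf\{s\ge0:P_\mu(s,\mathtt i)<0\}$. *)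

(* Defs.v *)
From HB Require Import structures.
From mathcomp Require Import all_boot all_order all_algebra.
From mathcomp Require Import all_classical all_reals all_analysis.
Set Implicit Arguments. Unset Strict Implicit. Unset Printing Implicit Defensive.
Import Order.TTheory GRing.Theory Num.Theory.
Local Open Scope classical_set_scope.
Local Open Scope ring_scope.

(* cylinder [w_1 ... w_n] determined by the first n letters of w
   (sequences are indexed from 0: w 0 = i_1) *)
Definition cyl {I : Type} (w : nat -> I) (n : nat) : set (nat -> I) :=
  [set j | forall l, (l < n)%N -> j l = w l].

Definition cylw {I : Type} {n : nat} (t : n.-tuple I) : set (nat -> I) :=
  [set j | forall l : 'I_n, j l = tnth t l].

Definition cylinders (I : Type) : set (set (nat -> I)) :=
  [set C | exists w n, C = @cyl I w n].

(* I^N with the sigma-algebra generated by cylinders, which for countable I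
   is the Borel sigma-algebra of the product of discrete topologies *)
Definition Iseq (I : pointedType) := g_sigma_algebraType (@cylinders I).

Definition sshift {I : Type} (j : nat -> I) : nat -> I := fun l => j l.+1.

Definition eucl {R : realType} {d : nat} (v : 'cV[R]_d) : R :=
  Num.sqrt (\sum_(k < d) v k ord0 ^+ 2).

Definition opnorm {R : realType} {d : nat} (M : 'M[R]_d) : R :=
  sup [set eucl (M *m v) | v in [set v : 'cV[R]_d | eucl v <= 1]].

Definition is_svd {R : realType} {d : nat} (M : 'M[R]_d) (s : 'rV[R]_d) : Prop :=
  (forall k l : 'I_d, (k <= l)%N -> s ord0 l <= s ord0 k) /\
  (forall k : 'I_d, 0 <= s ord0 k) /\
  exists U V : 'M[R]_d, U^T *m U = 1%:M /\ V^T *m V = 1%:M /\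
    M = U *m diag_mx s *m V^T.

Definition svals {R : realType} {d : nat} (M : 'M[R]_d) : 'rV[R]_d :=
  xget 0 [set s | is_svd M s].

(* alpha M l = alpha_{l+1}(M)  (0-based index) *)
Definition alpha {R : realType} {d : nat} (M : 'M[R]_d) (l : nat) : R :=
  nth 0 [seq svals M ord0 k | k <- enum 'I_d] l.

Definition phis {R : realType} {d : nat} (M : 'M[R]_d) (s : R) : R :=
  let k := Num.truncn s in
  if s < d%:R then (\prod_(l < k) alpha M l) * powR (alpha M k) (s - k%:R)
  else powR (\prod_(l < d) alpha M l) (s / d%:R).

Fixpoint wmx {R : realType} {d : nat} {I : Type} (A : I -> 'M[R]_d)
    (w : nat -> I) (n : nat) : 'M[R]_d :=
  match n with 0 => 1%:M | n'.+1 => wmx A w n' *m A (w n') end.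

Fixpoint fw {R : realType} {d : nat} {I : Type} (A : I -> 'M[R]_d)
    (a : I -> 'cV[R]_d) (w : nat -> I) (n : nat) (x : 'cV[R]_d) : 'cV[R]_d :=
  match n with 0 => x | n'.+1 => fw A a w n' (A (w n') *m x + a (w n')) end.

Definition piA {R : realType} {d : nat} {I : Type} (A : I -> 'M[R]_d)
    (a : I -> 'cV[R]_d) (Rad : R) (w : nat -> I) : 'cV[R]_d :=
  xget 0 [set x | forall n, exists y, eucl y <= Rad /\ x = fw A a w n y].

Local Open Scope ereal_scope.

Definition elog {R : realType} (p : R) : \bar R :=
  if p == 0%R then -oo else (ln p)%:E.

Definition Hn {I : pointedType} {R : realType} (mu : probability (Iseq I) R)
    (n : nat) : \bar R :=
  \esum_(t in [set: n.-tuple I])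
     (- (fine (mu (cylw t)) * ln (fine (mu (cylw t)))))%R%:E.

Definition hmu {I : pointedType} {R : realType} (mu : probability (Iseq I) R)
  : \bar R := limn (fun n => Hn mu n * (n%:R^-1)%R%:E).

Definition hloc {I : pointedType} {R : realType} (mu : probability (Iseq I) R)
    (w : nat -> I) : \bar R :=
  limn (fun n => - elog (fine (mu (cyl w n))) * (n%:R^-1)%R%:E).

Definition Lam {R : realType} {d : nat} {I : Type} (A : I -> 'M[R]_d)
    (s : R) (w : nat -> I) : \bar R :=
  limn (fun n => elog (phis (wmx A w n) s) * (n%:R^-1)%R%:E).

Definition Pmu {I : pointedType} {R : realType} {d : nat} (A : I -> 'M[R]_d)
    (mu : probability (Iseq I) R) (s : R) (w : nat -> I) : \bar R :=
  hloc mu w + Lam A s w.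

Definition dimLY {I : pointedType} {R : realType} {d : nat} (A : I -> 'M[R]_d)
    (mu : probability (Iseq I) R) (w : nat -> I) : \bar R :=
  ereal_inf [set s%:E | s in [set s : R | (0 <= s)%R /\ Pmu A mu s w < 0]].

Definition locratio {I : pointedType} {R : realType} {d : nat}
    (mu : probability (Iseq I) R) (p : (nat -> I) -> 'cV[R]_d)
    (x : 'cV[R]_d) (r : R) : \bar R :=
  let m := mu (p @^-1` [set y | (eucl (y - x) < r)%R]) in
  if m == 0 then +oo else (ln (fine m) / ln r)%R%:E.

Definition updimloc {I : pointedType} {R : realType} {d : nat}
    (mu : probability (Iseq I) R) (p : (nat -> I) -> 'cV[R]_d)
    (x : 'cV[R]_d) : \bar R :=
  ereal_inf [set ereal_sup (locratio mu p x @` [set r : R | (0 < r < delta)%R])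
            | delta in [set delta : R | (0 < delta)%R]].

(* Main.v *)
Require Import Defs.
From HB Require Import structures.
From mathcomp Require Import all_boot all_order all_algebra spectral complex fingroup perm.
From mathcomp Require Import all_classical all_reals all_analysis.
From mathcomp Require Import measurable_realfun zify ring lra.
Import Order.TTheory GRing.Theory Num.Theory.
Import numFieldNormedType.Exports.
Local Open Scope classical_set_scope.
Local Open Scope ring_scope.

(** For t in (k, k+1) with P_mu(t,w) < 0, the image of the cylinder [w|_n] lies in
    an ellipsoid that is covered by about phi^t(w|_n) / alpha_{k+1}(w|_n)^t balls of
    radius alpha_{k+1}(w|_n).  By Borel-Cantelli, for almost every w and all large n
    the ball of comparable radius around the projection of w has at least an
    e^{-n eps} proportion of the average share of mu[w|_n], which is at least
    alpha_{k+1}(w|_n)^{t + O(eps)}.  Since (1/n) log alpha_{k+1}(w|_n) has a finite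
    negative limit, these radii reach all scales.  The bound by d is the same argument
    with the empty word and radii e^{-n}.

    The limits exist by Kingman's theorem, proved by a greedy tiling of orbits and a
    maximal inequality.  For the singular values it is applied to the sum of the
    absolute values of the k-minors, which is submultiplicative by Cauchy-Binet and
    comparable to alpha_1 ... alpha_k.  For the entropy, -log mu[w|_n] is not
    subadditive; let Q(u) be the sum over all ways of cutting the word u into blocks
    of the product of the weights mu[block] / (l (l+1)), l being the length of the
    block.  Then Q(uv) >= Q(u) Q(v), the total of Q over words of length n is at
    most 1, and mu[u] / (n (n+1)) <= Q(u), so that -log Q is subadditive and, by
    Borel-Cantelli, differs from -log mu by O(log n) almost surely. *)

(** * Singular value decomposition *)

(** The measure is not assumed ergodic, so every limit, and with it the exponent t, depends on the
    point w. The exceptional null sets must be fixed before t is known. This is why the mass bound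
    for balls speaks only of alpha_1 ... alpha_k and alpha_{k+1}, for integers k < d and eps =
    1/(m+1): these are countably many statements, and t enters afterwards, by arithmetic at a single
    point.

    The assumption Lambda_mu(s) > -oo rules out radii alpha_{k+1}(w|_n) that decay
    superexponentially, which would leave gaps between consecutive scales. It is exploited at a
    non-integer t between the dimension and s. There Lambda_mu(t) is a combination, with two
    strictly positive coefficients, of the growth rates of alpha_1 ... alpha_k and alpha_1 ...
    alpha_{k+1}. Both rates are at most 0, so a finite combination forces each of them to be finite.
    Together with P_mu(t) < 0 this also makes the local entropy finite.

    Entropy and exponents are defined through [limn], which carries information only once
    convergence is established; hence the two ergodic theorems. *)

Section Eucl.
Context {R : realType}.

Definition dotc {n} (u v : 'cV[R]_n) : R := \sum_k u k ord0 * v k ord0.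

Lemma dotcE n (u v : 'cV[R]_n) : u^T *m v = (dotc u v)%:M.
Proof.
by rewrite [LHS]mx11_scalar mxE; congr (_%:M); apply: eq_bigr => k _; rewrite mxE.
Qed.

Lemma eucl_ge0 n (v : 'cV[R]_n) : 0 <= eucl v. Proof. exact: sqrtr_ge0. Qed.

Lemma sqr_eucl n (v : 'cV[R]_n) : eucl v ^+ 2 = dotc v v.
Proof.
rewrite sqr_sqrtr; last by apply: sumr_ge0 => k _; exact: sqr_ge0.
by apply: eq_bigr => k _; rewrite expr2.
Qed.

Lemma eucl_dotc n (v : 'cV[R]_n) : eucl v = Num.sqrt (dotc v v).
Proof. by rewrite -sqr_eucl sqrtr_sqr ger0_norm// eucl_ge0. Qed.

Lemma dotc_ge0 n (v : 'cV[R]_n) : 0 <= dotc v v.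
Proof. by rewrite -sqr_eucl sqr_ge0. Qed.

Lemma dotcC n (u v : 'cV[R]_n) : dotc u v = dotc v u.
Proof. by apply: eq_bigr => k _; rewrite mulrC. Qed.

Lemma dotcDl n (u v w : 'cV[R]_n) : dotc (u + v) w = dotc u w + dotc v w.
Proof. by rewrite -big_split; apply: eq_bigr => k _; rewrite mxE mulrDl. Qed.

Lemma dotcZl n a (u w : 'cV[R]_n) : dotc (a *: u) w = a * dotc u w.
Proof. by rewrite mulr_sumr; apply: eq_bigr => k _; rewrite mxE mulrA. Qed.

Lemma dotcDr n (u v w : 'cV[R]_n) : dotc w (u + v) = dotc w u + dotc w v.
Proof. by rewrite dotcC dotcDl ![dotc _ w]dotcC. Qed.

Lemma dotcZr n a (u w : 'cV[R]_n) : dotc w (a *: u) = a * dotc w u.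
Proof. by rewrite dotcC dotcZl dotcC. Qed.

Lemma dotc_mulmx n m (A : 'M[R]_(m, n)) (u : 'cV[R]_m) (v : 'cV[R]_n) :
  dotc u (A *m v) = dotc (A^T *m u) v.
Proof.
apply: (@fmorph_inj _ _ (idfun : {rmorphism R -> R})) => /=.
have /matrixP/(_ ord0 ord0) : (dotc u (A *m v))%:M = (dotc (A^T *m u) v)%:M :> 'M[R]_1.
  by rewrite -!dotcE trmx_mul trmxK mulmxA.
by rewrite !mxE !mulr1n.
Qed.

Lemma eucl_eq0 n (v : 'cV[R]_n) : (eucl v == 0) = (v == 0).
Proof.
apply/eqP/eqP => [v0|->]; last first.
  by rewrite eucl_dotc /dotc big1 ?sqrtr0// => k _; rewrite mxE mul0r.
have := sqr_eucl _ v; rewrite v0 expr0n /= => /esym/eqP.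
rewrite psumr_eq0; last by move=> k _; rewrite -expr2 sqr_ge0.
move=> /allP H; apply/matrixP => k j; rewrite ord1 mxE; apply/eqP.
by have := H k (mem_index_enum k); rewrite mulf_eq0 orbb.
Qed.

Lemma cauchy_schwarz n (u v : 'cV[R]_n) : dotc u v <= eucl u * eucl v.
Proof.
have [->|u0] := eqVneq u 0.
  rewrite (_ : dotc 0 v = 0) ?mulr_ge0 ?eucl_ge0//.
  by rewrite /dotc big1// => k _; rewrite mxE mul0r.
have eu : 0 < eucl u by rewrite lt_def eucl_eq0 u0 eucl_ge0.
have := dotc_ge0 _ (eucl v *: u + (- eucl u) *: v).
rewrite !(dotcDl, dotcDr, dotcZl, dotcZr) [dotc v u]dotcC -!sqr_eucl => H.
have [->|v0] := eqVneq v 0.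
  rewrite (_ : dotc u 0 = 0) ?mulr_ge0 ?eucl_ge0//.
  by rewrite /dotc big1// => k _; rewrite mxE mulr0.
have ev : 0 < eucl v by rewrite lt_def eucl_eq0 v0 eucl_ge0.
have : 0 <= (eucl u * eucl v) * (2 * (eucl u * eucl v - dotc u v)).
  by apply: le_trans H _; rewrite le_eqVlt; apply/orP; left; apply/eqP; ring.
by rewrite pmulr_rge0 ?mulr_gt0// pmulr_rge0// subr_ge0.
Qed.

Lemma eucl_triangle n (u v : 'cV[R]_n) : eucl (u + v) <= eucl u + eucl v.
Proof.
rewrite -(@ler_pXn2r _ 2)// ?nnegrE ?addr_ge0 ?eucl_ge0//.
rewrite sqr_eucl !(dotcDl, dotcDr) [dotc v u]dotcC -!sqr_eucl sqrrD.
have := cauchy_schwarz _ u v; lra.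
Qed.

Lemma euclZ n a (v : 'cV[R]_n) : eucl (a *: v) = `|a| * eucl v.
Proof.
by rewrite !eucl_dotc dotcZl dotcZr mulrA -expr2 sqrtrM ?sqr_ge0// sqrtr_sqr.
Qed.

Lemma euclN n (v : 'cV[R]_n) : eucl (- v) = eucl v.
Proof. by rewrite -scaleN1r euclZ normrN1 mul1r. Qed.

Lemma eucl_distC n (u v : 'cV[R]_n) : eucl (u - v) = eucl (v - u).
Proof. by rewrite -euclN opprB. Qed.

Lemma eucl_dist_triangle n (w u v : 'cV[R]_n) :
  eucl (u - v) <= eucl (u - w) + eucl (w - v).
Proof. by apply: le_trans (eucl_triangle _ _ _); rewrite addrA subrK. Qed.

Lemma eucl0 n : eucl (0 : 'cV[R]_n) = 0.
Proof. by apply/eqP; rewrite eucl_eq0. Qed.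

Lemma coord_le_eucl n (v : 'cV[R]_n) k : `|v k ord0| <= eucl v.
Proof.
rewrite -(@ler_pXn2r _ 2)// ?nnegrE ?eucl_ge0// sqr_eucl real_normK ?num_real//.
rewrite /dotc (bigD1 k)//= -expr2 lerDl; apply: sumr_ge0 => j _.
by rewrite -expr2 sqr_ge0.
Qed.

Lemma eucl_le_sum n (v : 'cV[R]_n) : eucl v <= \sum_k `|v k ord0|.
Proof.
have S0 : 0 <= \sum_k `|v k ord0| by apply: sumr_ge0.
rewrite -(@ler_pXn2r _ 2)// ?nnegrE ?eucl_ge0// sqr_eucl expr2 mulr_suml.
apply: ler_sum => k _; rewrite -expr2 -real_normK ?num_real// expr2.
by rewrite ler_wpM2l// (bigD1 k)//= lerDl; apply: sumr_ge0.
Qed.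

Lemma eucl_orth n (U : 'M[R]_n) (v : 'cV[R]_n) : U^T *m U = 1%:M ->
  eucl (U *m v) = eucl v.
Proof. by move=> UU; rewrite !eucl_dotc dotc_mulmx mulmxA UU mul1mx. Qed.

Lemma eucl_mulmx_le n (M : 'M[R]_n) (v : 'cV[R]_n) :
  eucl (M *m v) <= opnorm M * eucl v.
Proof.
have [->|v0] := eqVneq v 0; first by rewrite mulmx0 eucl0 mulr0.
have ev : 0 < eucl v by rewrite lt_def eucl_eq0 v0 eucl_ge0.
rewrite -ler_pdivrMr//.
have -> : eucl (M *m v) / eucl v = eucl (M *m ((eucl v)^-1 *: v)).
  by rewrite -scalemxAr euclZ ger0_norm ?invr_ge0 ?ltW// mulrC.
apply: ub_le_sup; last first.
  exists ((eucl v)^-1 *: v) => //=.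
  by rewrite euclZ ger0_norm ?invr_ge0 ?(ltW ev)// mulVf ?gt_eqF.
(* [sup] is a genuine supremum only for a bounded set; the sum of the absolute entries bounds this
   one. *)
exists (\sum_k \sum_j `|M k j|) => _ [x /= x1 <-].
apply: le_trans (eucl_le_sum _ _) _; apply: ler_sum => k _; rewrite mxE.
apply: le_trans (ler_norm_sum _ _ _) _; apply: ler_sum => j _.
by rewrite normrM ler_piMr// (le_trans (coord_le_eucl _ _ _)).
Qed.

End Eucl.

Section SVD.
Context {R : realType}.

(** Over the complex numbers the spectral theorem for Hermitian matrices provides a real eigenvalue,
    and being a root of the characteristic polynomial descends to [R]. *)
Lemma symmetric_eigenvalue n (S : 'M[R]_n.+1) : S^T = S -> exists a, eigenvalue S a.
Proof.
move=> Ssym; pose toC := real_complex R.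
pose A := map_mx toC S.
have Ah : A \is hermsymmx.
  apply: realsym_hermsym.
    apply/is_hermitianmxP; rewrite expr0 scale1r; apply/matrixP => i j.
    by rewrite !mxE /= -{1}Ssym mxE.
  by apply/mxOverP => i j; rewrite mxE; apply/complex_realP; exists (S i j).
have sr := hermitian_spectral_diag_real Ah.
have /hermitian_normalmx/orthomx_spectralP AE := Ah.
set P := spectralmx A in AE; set sp := spectral_diag A in AE sr.
have Pu : P \in unitmx by exact: spectral_unit.
have PA : P *m A = diag_mx sp *m P by rewrite {1}AE -mulmxA mulKVmx.
have ev : eigenvalue A (sp 0 0).
  apply/eigenvalueP; exists (row 0 P).
    by rewrite -row_mul PA; apply/rowP => j; rewrite mul_diag_mx !mxE.
  apply: contraTneq Pu => r0; rewrite unitmxE unitfE negbK.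
  rewrite (expand_det_row _ 0) big1// => j _.
  by have /matrixP/(_ 0 j) := r0; rewrite !mxE => ->; rewrite mul0r.
have /complex_realP[r rE] : sp 0 0 \is Num.real by exact: (mxOverP sr).
exists r; rewrite eigenvalue_root_char.
by move: ev; rewrite eigenvalue_root_char rE -map_char_poly fmorph_root.
Qed.

(** For w <> e, the reflection 1 - (2 / |z|^2) z z^T with z = w - e exchanges the unit vectors [e]
    and [w]. *)
Lemma householder n (w : 'cV[R]_n.+1) : eucl w = 1 ->
  exists P : 'M[R]_n.+1, P^T *m P = 1%:M /\ P *m delta_mx 0 0 = w.
Proof.
move=> w1; pose e : 'cV[R]_n.+1 := delta_mx 0 0.
have [we|we] := eqVneq w e.
  by exists 1%:M; rewrite trmx1 mulmx1 mul1mx.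
pose z := w - e; pose c := dotc z z.
have c0 : c != 0 by rewrite /c -sqr_eucl sqrf_eq0 eucl_eq0 subr_eq0.
have we1 : dotc w w = 1 by rewrite -sqr_eucl w1 expr1n.
have dotce v : dotc v e = v 0 0.
  rewrite /dotc (bigD1 0)//= big1 ?mxE ?eqxx ?mulr1 ?addr0// => k k0.
  by rewrite mxE (negPf k0) mulr0.
have ze : dotc z e = - c / 2.
  have zE : z = w + (-1) *: e by rewrite scaleN1r.
  have e00 : e 0 0 = 1 by rewrite mxE.
  rewrite /c zE !(dotcDl, dotcDr, dotcZl, dotcZr) [dotc e w]dotcC we1 !dotce e00.
  by field.
have zz : z^T *m z = c%:M by rewrite dotcE.
have zzt : z *m z^T *m (z *m z^T) = c *: (z *m z^T).
  by rewrite mulmxA -(mulmxA z) zz mul_mx_scalar -scalemxAl.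
have sym : (z *m z^T)^T = z *m z^T by rewrite trmx_mul trmxK.
exists (1%:M - (2 / c) *: (z *m z^T)); split.
  set P := (X in X^T *m X).
  have -> : P^T = P.
    rewrite -{2}[P]/(1%:M - (2 / c) *: (z *m z^T)) -[in RHS]sym.
    by apply/matrixP => i j; rewrite /P !mxE eq_sym; congr (_ - _ * _); apply: eq_bigr => l _; rewrite !mxE mulrC.
  rewrite /P mulmxBl mul1mx mulmxBr mulmx1.
  rewrite -scalemxAl -scalemxAr zzt !scalerA.
  have -> : 2 / c * (2 / c) * c = 2 / c + 2 / c by field.
  by rewrite scalerDl opprB addrK subrK.
rewrite mulmxBl mul1mx -scalemxAl -mulmxA dotcE ze mul_mx_scalar scalerA.
have -> : 2 / c * (- c / 2) = -1 by field.
by rewrite scaleN1r opprK addrC subrK.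
Qed.

(** Take a unit eigenvector x of M^T M, sg = |M x| and u = M x / sg, where sg > 0 since M is
    invertible. Then M x = sg u and M^T u = sg x, so in orthonormal bases beginning with u and x the
    matrix is block diagonal, and the induction continues with the lower block. *)
Lemma svd_unsorted n (M : 'M[R]_n) : M \in unitmx ->
  exists U V : 'M[R]_n, exists s : 'rV[R]_n,
    [/\ U^T *m U = 1%:M, V^T *m V = 1%:M, forall k, 0 <= s 0 k &
        M = U *m diag_mx s *m V^T].
Proof.
elim: n M => [|n IH] M Mu.
  by exists 1%:M, 1%:M, 0; split; [rewrite mulmx1 trmx1|rewrite mulmx1 trmx1|case|]
    => //; apply/matrixP => -[].
have [a /eigenvalueP[v vE v0]] := symmetric_eigenvalue n (M^T *m M) ltac:(by rewrite trmx_mul trmxK).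
pose x := (eucl v^T)^-1 *: v^T.
have ev : 0 < eucl v^T by rewrite lt_def eucl_ge0 eucl_eq0 trmx_eq0 v0.
have x1 : eucl x = 1 by rewrite euclZ ger0_norm ?invr_ge0 ?ltW// mulVf ?gt_eqF.
have HxE : M^T *m (M *m x) = a *: x.
  rewrite /x -!scalemxAr scalerA [a * _]mulrC -scalerA; congr (_ *: _).
  by apply: trmx_inj; rewrite !trmx_mul !trmxK -mulmxA vE linearZ /= trmxK.
have aE : a = eucl (M *m x) ^+ 2.
  by rewrite sqr_eucl dotc_mulmx HxE dotcZl -sqr_eucl x1 expr1n mulr1.
pose sg := eucl (M *m x).
have sg0 : 0 < sg.
  rewrite lt_def eucl_ge0 eucl_eq0 andbT.
  apply: contra_eq_neq x1 => Mx0.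
  by rewrite -[x](mulKmx Mu) Mx0 mulmx0 eucl0 eq_sym oner_eq0.
pose u := sg^-1 *: (M *m x).
have u1 : eucl u = 1 by rewrite euclZ ger0_norm ?invr_ge0 ?ltW// mulVf ?gt_eqF.
have MxE : M *m x = sg *: u by rewrite scalerA mulfV ?gt_eqF// scale1r.
have MuE : M^T *m u = sg *: x.
  by rewrite /u -scalemxAr HxE scalerA aE -/sg expr2 mulrA mulVf ?gt_eqF// mul1r.
have [U1 [UU Ue]] := householder n u u1.
have [V1 [VV Ve]] := householder n x x1.
have UUt := mulmx1C UU; have VVt := mulmx1C VV.
pose N : 'M[R]_(1 + n) := U1^T *m M *m V1.
have Ne : N *m delta_mx 0 0 = sg *: (delta_mx 0 0 : 'cV_(1 + n)).
  by rewrite /N -!mulmxA Ve MxE -scalemxAr -Ue mulmxA UU mul1mx.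
have eN : N^T *m delta_mx 0 0 = sg *: (delta_mx 0 0 : 'cV_(1 + n)).
  by rewrite /N !trmx_mul trmxK -!mulmxA Ue MuE -scalemxAr -Ve mulmxA VV mul1mx.
have ND : N = U1^T *m M *m V1 by [].
clearbody N.
have colN (Q : 'M[R]_(1 + n)) i : (Q *m delta_mx 0 0 : 'cV_(1 + n)) i 0 = Q i 0.
  rewrite mxE (bigD1 0)//= big1 ?mxE ?eqxx ?mulr1 ?addr0// => k k0.
  by rewrite mxE (negPf k0) mulr0.
have N0 i : N i 0 = sg *+ (i == 0).
  by rewrite -colN Ne !mxE eqxx andbT mulr_natr.
have N0' i : N 0 i = sg *+ (i == 0).
  have -> : N 0 i = N^T i 0 by rewrite mxE.
  by rewrite -colN eN !mxE eqxx andbT mulr_natr.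
pose M' : 'M[R]_n := drsubmx N.
have NE : N = block_mx sg%:M 0 0 M'.
  rewrite -[N]submxK; congr block_mx.
  - apply/matrixP => i j; rewrite !mxE !ord1.
    have -> : lshift n (0 : 'I_1) = 0 :> 'I_(1 + n) by exact: val_inj.
    by rewrite N0.
  - apply/matrixP => i j; rewrite !mxE !ord1.
    have -> : lshift n (0 : 'I_1) = 0 :> 'I_(1 + n) by exact: val_inj.
    by rewrite N0'.
  - apply/matrixP => i j; rewrite !mxE !ord1.
    have -> : lshift n (0 : 'I_1) = 0 :> 'I_(1 + n) by exact: val_inj.
    by rewrite N0.
have M'u : M' \in unitmx.
  have : N \in unitmx.
    rewrite ND !unitmx_mul Mu andbT unitmx_tr.
    by rewrite (mulmx1_unit UU).2 (mulmx1_unit VV).2.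
  by rewrite !unitmxE NE det_ublock unitrM => /andP[].
have [U' [V' [s' [UU' VV' s0 M'E]]]] := IH M' M'u.
pose B (W : 'M[R]_n) : 'M[R]_(1 + n) := block_mx 1%:M 0 0 W.
have BB W : W^T *m W = 1%:M -> (B W)^T *m B W = 1%:M.
  move=> WW; rewrite /B tr_block_mx mulmx_block !trmx0 !trmx1 !mul0mx !mulmx0.
  by rewrite mulmx1 WW !addr0 add0r -scalar_mx_block.
pose s : 'rV[R]_(1 + n) := row_mx sg%:M s'.
have sE : diag_mx s = block_mx sg%:M 0 0 (diag_mx s').
  rewrite /s diag_mx_row; congr block_mx.
  by apply/matrixP => i j; rewrite !mxE !ord1 eqxx.
have core : N = B U' *m diag_mx s *m (B V')^T.
  rewrite {1}NE {1}M'E sE /B tr_block_mx !trmx0 !trmx1 !mulmx_block.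
  by rewrite !(mul0mx, mulmx0, mul1mx, mulmx1, addr0, add0r).
exists (U1 *m B U'), (V1 *m B V'), s; split.
- rewrite trmx_mul mulmxA -(mulmxA _ U1^T) UU mulmx1; exact: (BB _ UU').
- rewrite trmx_mul mulmxA -(mulmxA _ V1^T) VV mulmx1; exact: (BB _ VV').
- move=> k; rewrite /s mxE; case: splitP => j _ //.
  by rewrite ord1 mxE eqxx mulr1n ltW.
have -> : M = U1 *m N *m V1^T.
  by rewrite ND !mulmxA UUt mul1mx -mulmxA VVt mulmx1.
rewrite trmx_mul !mulmxA; congr (_ *m _); rewrite -!mulmxA; congr (_ *m _).
by rewrite mulmxA; exact: core.
Qed.

(** Sorting permutes the diagonal; the permutation matrix is absorbed into [U] and [V]. *)
Lemma svd_exists n (M : 'M[R]_n) : M \in unitmx -> exists s, is_svd M s.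
Proof.
move=> Mu; have [U [V [s [UU VV s0 ME]]]] := svd_unsorted n M Mu.
pose ge := (fun x y : R => y <= x).
have ge_tot : total ge by move=> x y; exact: le_total.
have ge_tr : transitive ge by move=> y x z xy yz; exact: le_trans yz xy.
pose t := [tuple s 0 k | k < n].
have /tuple_permP[p pE] : perm_eq (sort ge t) t by rewrite perm_sort.
exists (\row_k s 0 (p k)); split.
  move=> k l kl; rewrite !mxE.
  have srt : sorted ge (sort ge t) by exact: sort_sorted.
  have nthE (j : 'I_n) : nth 0 (sort ge t) j = s 0 (p j).
    rewrite pE (nth_map j) ?size_enum_ord// nth_ord_enum tnth_mktuple//.
  rewrite -!nthE; apply: (sorted_leq_nth ge_tr (lexx : reflexive ge) 0 srt) => //;
    by rewrite inE size_sort size_tuple.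
split; first by move=> k; rewrite mxE.
exists (U *m (perm_mx p)^T), (V *m (perm_mx p)^T).
have pp : perm_mx p *m (perm_mx p)^T = 1%:M :> 'M[R]_n.
  by rewrite tr_perm_mx -perm_mxM mulgV perm_mx1.
split; first by rewrite trmx_mul trmxK mulmxA -(mulmxA _ U^T) UU mulmx1.
split; first by rewrite trmx_mul trmxK mulmxA -(mulmxA _ V^T) VV mulmx1.
rewrite ME trmx_mul trmxK !mulmxA; congr (_ *m _); rewrite -!mulmxA; congr (_ *m _).
have -> : diag_mx (\row_k s 0 (p k)) = perm_mx p *m diag_mx s *m (perm_mx p)^T :> 'M[R]_n.
  rewrite tr_perm_mx -row_permE -col_permE; apply/matrixP => i j; rewrite !mxE.
  by rewrite (inj_eq perm_inj).
by rewrite !mulmxA (mulmx1C pp) mul1mx -mulmxA (mulmx1C pp) mulmx1.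
Qed.

End SVD.

(** * Minors and products of singular values *)

(** Split off the index where [f] is largest: by injectivity that value is at least the last index
    on the right, so its factor is at most the last factor there. *)
Lemma prod_inj_le {R : realType} (k : nat) (f : 'I_k -> nat) (s : nat -> R) :
  injective f -> (forall l, 0 <= s l) -> (forall m n, (m <= n)%N -> s n <= s m) ->
  \prod_(i < k) s (f i) <= \prod_(l < k) s l.
Proof.
move=> finj s0 smono; elim: k f finj => [|k IH] f finj; first by rewrite !big_ord0.
pose m := [arg max_(i > ord0) f i].
have fm i : (f i <= f m)%N by rewrite /m; case: arg_maxnP => // j _; apply.
have kfm : (k <= f m)%N.
  rewrite leqNgt; apply/negP => fmk.
  have lt i : (f i < k)%N by apply: leq_ltn_trans fmk.
  have : injective (fun i => Ordinal (lt i)) by move=> i j [/finj].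
  by move/leq_card; rewrite !card_ord ltnn.
rewrite (bigD1 m)//= big_ord_recr /= mulrC ler_pM//.
- by apply: prodr_ge0.
- rewrite (eq_bigl (fun i => i \in [set lift m j | j in 'I_k]%SET)); last first.
    move=> i; apply/idP/imsetP => [im|[j _ ->]]; last by rewrite eq_sym neq_lift.
    by case: (unliftP m i) im => [j ->|->]; [exists j|rewrite eqxx].
  rewrite big_imset /=; last by move=> i j _ _; exact: lift_inj.
  rewrite (eq_bigl xpredT)//; apply: IH.
  by move=> i j /finj/lift_inj.
- exact: smono.
Qed.

Section Compound.
Context {R : realType} {d k : nat}.
Implicit Types (A B : 'M[R]_d) (f g h : {ffun 'I_k -> 'I_d}).

Definition kminor A f g : R := \det (\matrix_(i < k, j < k) A (f i) (g j)).

(** The entrywise l^1 norm of the k-th exterior power, with each minor counted once for every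
    ordering of its rows and of its columns; choices with a repeated index contribute 0. *)
Definition compound_norm A : R :=
  \sum_(f : {ffun 'I_k -> 'I_d}) \sum_(g : {ffun 'I_k -> 'I_d}) `|kminor A f g|.

(** Multilinearity in the rows leaves products of entries of [A]. Reindexing [h] by a permutation
    brings out its sign without changing the sum; adding over all k! permutations then completes
    these products to minors of [A]. *)
Lemma kminor_mul_expand A B f g :
  kminor (A *m B) f g =
  \sum_(h : {ffun 'I_k -> 'I_d}) (\prod_i A (f i) (h i)) * kminor B h g.
Proof.
rewrite /kminor /determinant.
under [RHS]eq_bigr => h _ do rewrite mulr_sumr.
rewrite [RHS]exchange_big /=; apply: eq_bigr => s _.
under eq_bigr => i _ do rewrite !mxE.
rewrite (bigA_distr_bigA (fun i l => A (f i) l * B l (g (s i)))) /= mulr_sumr.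
apply: eq_bigr => h _; rewrite big_split /= mulrCA; congr (_ * (_ * _)).
by apply: eq_bigr => i _; rewrite mxE.
Qed.

Lemma kminor_permute B h g (t : 'S_k) :
  kminor B [ffun i => h (t i)] g = (-1) ^+ t * kminor B h g.
Proof.
rewrite /kminor -det_perm -det_mulmx -row_permE; congr (\det _).
by apply/matrixP => i j; rewrite !mxE ffunE.
Qed.

(* Cauchy-Binet, over all index functions rather than increasing ones. *)
Lemma kminor_mul A B f g :
  (k`!)%:R * kminor (A *m B) f g = \sum_h kminor A f h * kminor B h g.
Proof.
have key (t : 'S_k) : kminor (A *m B) f g =
    \sum_(h : {ffun 'I_k -> 'I_d})
      (-1) ^+ t * (\prod_i A (f i) (h (t i))) * kminor B h g.
  rewrite kminor_mul_expand.
  rewrite (reindex_inj (h := fun h => [ffun i => h (t i)])) /=; last first.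
    move=> h h' /ffunP H; apply/ffunP => i.
    by have := H (t^-1%g i); rewrite !ffunE permKV.
  apply: eq_bigr => h _; rewrite kminor_permute mulrCA mulrA; congr (_ * _ * _).
  by apply: eq_bigr => i _; rewrite ffunE.
transitivity (\sum_(t : 'S_k) kminor (A *m B) f g).
  by rewrite sumr_const -(card_Sn k) mulr_natl.
under eq_bigr => t _ do rewrite (key t).
rewrite exchange_big /=; apply: eq_bigr => h _; rewrite -mulr_suml; congr (_ * _).
rewrite /kminor /determinant; apply: eq_bigr => t _; congr (_ * _).
by apply: eq_bigr => i _; rewrite mxE.
Qed.

Lemma compound_norm_ge0 A : 0 <= compound_norm A.
Proof. by apply: sumr_ge0 => f _; apply: sumr_ge0. Qed.

(** The factor k! of [kminor_mul] is at least 1 and is dropped on the left. The inequality then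
    carries no constant, so the logarithm of the norm is exactly subadditive. *)
Lemma compound_norm_mul A B :
  compound_norm (A *m B) <= compound_norm A * compound_norm B.
Proof.
pose rs f := \sum_g `|kminor B f g|.
have rsB f : rs f <= compound_norm B.
  by rewrite /compound_norm (bigD1 f)//= lerDl; apply: sumr_ge0 => g _; exact: sumr_ge0.
rewrite {1 2}/compound_norm mulr_suml; apply: ler_sum => f _.
have kf0 : 0 < (k`!)%:R :> R by rewrite ltr0n fact_gt0.
apply: (@le_trans _ _ (\sum_g \sum_h `|kminor A f h| * `|kminor B h g|)).
  apply: ler_sum => g _.
  have /(congr1 (fun x => `|x|)) := kminor_mul A B f g.
  rewrite normrM ger0_norm ?(ltW kf0)// => E.
  apply: (@le_trans _ _ ((k`!)%:R * `|kminor (A *m B) f g|)).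
    by rewrite ler_peMl// ler1n fact_gt0.
  rewrite E; apply: le_trans (ler_norm_sum _ _ _) _.
  by apply: ler_sum => h _; rewrite normrM.
rewrite exchange_big /= mulr_suml; apply: ler_sum => h _.
by rewrite -mulr_sumr ler_wpM2l// rsB.
Qed.

Lemma kminor_le (c : R) A f g :
  (forall s : 'S_k, `|\prod_i A (f i) (g (s i))| <= c) ->
  `|kminor A f g| <= c *+ k`!.
Proof.
move=> H; rewrite /kminor /determinant; apply: le_trans (ler_norm_sum _ _ _) _.
have <- : \sum_(s : 'S_k) c = c *+ k`! by rewrite sumr_const -(card_Sn k).
apply: ler_sum => s _; rewrite normrM normrX normrN1 expr1n mul1r.
by under eq_bigr => i _ do rewrite mxE.
Qed.

(** The number of pairs of index functions times the number k! of terms of a determinant. *)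
Definition compound_const : R :=
  \sum_(f : {ffun 'I_k -> 'I_d}) \sum_(g : {ffun 'I_k -> 'I_d}) (1 *+ k`!).

(** If [f] is not injective, two rows coincide and the minor vanishes. Restricting the bound to
    injective [f] is what lets [prod_inj_le] handle a diagonal matrix. *)
Lemma compound_norm_le (c : R) A :
  (forall f g (s : 'S_k), injective f -> `|\prod_i A (f i) (g (s i))| <= c) ->
  0 <= c ->
  compound_norm A <= compound_const * c.
Proof.
move=> H c0; rewrite mulr_suml; apply: ler_sum => f _.
rewrite mulr_suml; apply: ler_sum => g _.
rewrite mulrnAl mul1r.
have [finj|fninj] := pselect (injective f).
  by apply: kminor_le => s; exact: H.
have [i [j [ij fij]]] : exists i j, i != j /\ f i = f j.
  apply: contrapT => Hn; apply: fninj => i j fij; apply/eqP; apply: contrapT => /negP ij.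
  by apply: Hn; exists i, j.
rewrite /kminor (determinant_alternate ij) ?normr0 ?mulrn_wge0// => l.
by rewrite !mxE fij.
Qed.

Lemma compound_norm_orth U : U^T *m U = 1%:M -> compound_norm U <= compound_const.
Proof.
move=> UU; rewrite -[leRHS]mulr1; apply: compound_norm_le => // f g s _.
rewrite normr_prod -[leRHS](_ : \prod_(i < k) 1 = _); last by rewrite big1.
apply: ler_prod => i _; rewrite normr_ge0 /=.
have /matrixP/(_ (g (s i)) (g (s i))) := UU.
rewrite !mxE eqxx mulr1n => E.
rewrite -(@ler_pXn2r _ 2)// ?nnegrE// expr1n -E real_normK ?num_real//.
rewrite (bigD1 (f i))//= mxE expr2 lerDl; apply: sumr_ge0 => j _.
by rewrite mxE -expr2 sqr_ge0.
Qed.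

End Compound.

Arguments compound_norm {R d} k A.

Section SingularValues.
Context {R : realType} {d : nat}.
Variable M : 'M[R]_d.
Hypothesis Mu : M \in unitmx.

Lemma svals_svd : is_svd M (svals M).
Proof. by rewrite /svals; apply: xgetPex; exact: svd_exists. Qed.

Lemma alphaE (l : 'I_d) : alpha M l = svals M ord0 l.
Proof.
by rewrite /alpha (nth_map l) ?size_enum_ord// nth_ord_enum.
Qed.

Lemma alpha_default l : (d <= l)%N -> alpha M l = 0.
Proof. by move=> dl; rewrite /alpha nth_default// size_map size_enum_ord. Qed.

Lemma svals_gt0 l : 0 < svals M ord0 l.
Proof.
have [_ [s0 [U [V [UU [VV ME]]]]]] := svals_svd.
rewrite lt_def s0 andbT; apply/eqP => sl0.
move: Mu; rewrite unitmxE unitfE ME !det_mulmx det_diag (bigD1 l)//= sl0.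
by rewrite mul0r mulr0 mul0r eqxx.
Qed.

Lemma alpha_gt0 l : (l < d)%N -> 0 < alpha M l.
Proof. by move=> ld; rewrite -[l]/(nat_of_ord (Ordinal ld)) alphaE svals_gt0. Qed.

Lemma alpha_ge0 l : 0 <= alpha M l.
Proof.
by have [/alpha_default ->//|ld] := leqP d l; exact/ltW/alpha_gt0.
Qed.

Lemma alpha_mono m n : (m <= n)%N -> alpha M n <= alpha M m.
Proof.
move=> mn; have [/alpha_default ->|nd] := leqP d n; first exact: alpha_ge0.
have md := leq_ltn_trans mn nd.
rewrite -[n]/(nat_of_ord (Ordinal nd)) -[m]/(nat_of_ord (Ordinal md)) !alphaE.
by have [H _] := svals_svd; exact: H.
Qed.

Lemma svals_le c : (forall v, eucl (M *m v) <= c * eucl v) ->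
  forall l, svals M ord0 l <= c.
Proof.
move=> Hc l; have [_ [s0 [U [V [UU [VV ME]]]]]] := svals_svd.
pose e : 'cV[R]_d := delta_mx l ord0.
have e1 : eucl e = 1.
  rewrite eucl_dotc /dotc (bigD1 l)//= big1 ?mxE ?eqxx ?mulr1 ?addr0 ?sqrtr1// => k kl.
  by rewrite mxE (negPf kl) mulr0.
have MVe : M *m (V *m e) = U *m (diag_mx (svals M) *m e).
  by rewrite {1}ME -!mulmxA [V^T *m _]mulmxA VV mul1mx.
have := Hc (V *m e); rewrite [eucl (V *m e)]eucl_orth// e1 mulr1 MVe eucl_orth//.
apply: le_trans; apply: le_trans (coord_le_eucl _ _ l).
rewrite mul_diag_mx mxE /e mxE !eqxx mulr1; exact: ler_norm.
Qed.

Lemma alpha_le c l : 0 <= c -> (forall v, eucl (M *m v) <= c * eucl v) -> alpha M l <= c.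
Proof.
move=> c0 Hc; have [/alpha_default ->//|ld] := leqP d l.
by rewrite -[l]/(nat_of_ord (Ordinal ld)) alphaE svals_le.
Qed.

Section Comparison.
Variable k : nat.
Hypothesis kd : (k <= d)%N.
Let phi := \prod_(l < k) alpha M l.
Let C : R := @compound_const R d k.

Lemma prod_alpha_gt0 : 0 < phi.
Proof. by apply: prodr_gt0 => l _; apply: alpha_gt0; exact: leq_trans kd. Qed.

Lemma compound_norm_svd : exists U V : 'M[R]_d,
  [/\ U^T *m U = 1%:M, V^T *m V = 1%:M & M = U *m diag_mx (svals M) *m V^T].
Proof. by have [_ [s0 [U [V [UU [VV ME]]]]]] := svals_svd; exists U, V. Qed.

Lemma compound_norm_diag :
  phi <= compound_norm k (diag_mx (svals M)) <= C * phi.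
Proof.
apply/andP; split; last first.
  apply: compound_norm_le; last exact/ltW/prod_alpha_gt0.
  move=> f g s finj.
  apply: (@le_trans _ _ (\prod_i alpha M (f i))).
    rewrite normr_prod; apply: ler_prod => i _; rewrite normr_ge0 /= mxE.
    rewrite alphaE; case: eqP => _; rewrite ?mulr1n ?mulr0n ?normr0 ?gtr0_norm ?svals_gt0//.
    exact/ltW/svals_gt0.
  apply: (prod_inj_le k (fun i => f i) (alpha M)).
  - by move=> i j /val_inj/finj.
  - exact: alpha_ge0.
  - exact: alpha_mono.
(* The leading minor is exactly alpha_1 ... alpha_k, and the other minors only add to the norm. *)
pose io : {ffun 'I_k -> 'I_d} := [ffun i => widen_ord kd i].
have phiE : kminor (diag_mx (svals M)) io io = phi.
  rewrite /kminor; have -> : \matrix_(i, j) diag_mx (svals M) (io i) (io j) =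
      diag_mx (\row_(i < k) alpha M i).
    apply/matrixP => i j; rewrite !mxE !ffunE.
    rewrite -[val i]/(nat_of_ord (widen_ord kd i)) alphaE.
    by rewrite (inj_eq (f := widen_ord kd))// => x y /(congr1 val) /= /val_inj.
  by rewrite det_diag; apply: eq_bigr => i _; rewrite mxE.
rewrite -phiE; apply: le_trans (ler_norm _) _.
rewrite /compound_norm (bigD1 io)//= (bigD1 io)//= -addrA lerDl addr_ge0//.
  exact: sumr_ge0.
by apply: sumr_ge0 => f _; exact: sumr_ge0.
Qed.

(** One [C] for each orthogonal factor and one for the diagonal factor. *)
Lemma compound_norm_upper : compound_norm k M <= C ^+ 3 * phi.
Proof.
have [U [V [UU VV ME]]] := compound_norm_svd.
have VV' : (V^T)^T *m V^T = 1%:M by rewrite trmxK; exact: mulmx1C.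
have /andP[_ D] := compound_norm_diag.
rewrite {1}ME; apply: le_trans (compound_norm_mul _ _) _.
have -> : C ^+ 3 * phi = (C * (C * phi)) * C by ring.
apply: ler_pM; rewrite ?compound_norm_ge0 ?compound_norm_orth//.
apply: le_trans (compound_norm_mul _ _) _.
by apply: ler_pM; rewrite ?compound_norm_ge0 ?compound_norm_orth.
Qed.

(** Solve for the diagonal factor as U^T M V: only the two orthogonal factors cost a [C]. *)
Lemma compound_norm_lower : phi <= C ^+ 2 * compound_norm k M.
Proof.
have [U [V [UU VV ME]]] := compound_norm_svd.
have UU' : (U^T)^T *m U^T = 1%:M by rewrite trmxK; exact: mulmx1C.
have /andP[D _] := compound_norm_diag.
apply: (le_trans D).
have -> : diag_mx (svals M) = U^T *m M *m V.
  by rewrite [in RHS]ME !mulmxA UU mul1mx -mulmxA VV mulmx1.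
apply: le_trans (compound_norm_mul _ _) _.
have -> : C ^+ 2 * compound_norm k M = (C * compound_norm k M) * C by ring.
apply: ler_pM; rewrite ?compound_norm_ge0 ?compound_norm_orth//.
apply: le_trans (compound_norm_mul _ _) _.
by apply: ler_pM; rewrite ?compound_norm_ge0 ?compound_norm_orth.
Qed.

Lemma compound_norm_gt0 : 0 < compound_norm k M.
Proof.
rewrite lt_def compound_norm_ge0 andbT; apply/eqP => E.
have := lt_le_trans prod_alpha_gt0 compound_norm_lower.
by rewrite E mulr0 ltxx.
Qed.

End Comparison.
End SingularValues.

(** * Subadditive ergodic theorem *)

Lemma measurable_set_le {d} {T : measurableType d} {R : realType}
  (f g : T -> R) : measurable_fun [set: T] f -> measurable_fun [set: T] g ->
  measurable [set x | f x <= g x].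
Proof.
move=> mf mg; rewrite -[X in measurable X]setTI.
exact: measurable_fun_le.
Qed.

Lemma measurable_set_lt {d} {T : measurableType d} {R : realType}
  (f g : T -> R) : measurable_fun [set: T] f -> measurable_fun [set: T] g ->
  measurable [set x | f x < g x].
Proof.
move=> mf mg; have -> : [set x | f x < g x] = ~` [set x | g x <= f x].
  by apply/seteqP; split => x /=; rewrite ltNge => /negP.
by apply: measurableC; exact: measurable_set_le.
Qed.

(** * Birkhoff sums and the maximal inequality for a measure-preserving map *)

Section MeasurePreserving.
Context {d : measure_display} {T : measurableType d} {R : realType}.
Variables (mu : probability T R) (f : T -> T).
Hypothesis mf : measurable_fun [set: T] f.
Hypothesis finv : forall E, measurable E -> mu (f @^-1` E) = mu E.

Definition bsum (g : T -> R) (n : nat) (x : T) : R :=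
  \sum_(k < n) g (iter k f x).

Lemma measurable_iter k : measurable_fun [set: T] (iter k f).
Proof.
elim: k => [|k IH]; first exact: measurable_id.
exact: (measurableT_comp mf IH).
Qed.

Lemma measure_iter k E : measurable E -> mu (iter k f @^-1` E) = mu E.
Proof.
move=> mE; elim: k => [//|k IH].
rewrite -IH -(finv (iter k f @^-1` E)); last first.
  by rewrite -[X in measurable X]setTI; exact: measurable_iter.
by congr (mu _); apply/seteqP; split => x /=; rewrite -iterSr.
Qed.

Lemma ge0_integral_iter k (g : T -> \bar R) : measurable_fun [set: T] g ->
  (forall x, 0 <= g x)%E ->
  (\int[mu]_x g (iter k f x) = \int[mu]_x g x)%E.
Proof.
move=> mg g0.
have := @ge0_integral_pushforward _ _ T T R (iter k f) (measurable_iter k) mu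
  setT g measurableT mg (fun y _ => g0 y).
rewrite preimage_setT => <-.
apply: eq_measure_integral => [|? A mA _]; first exact: measurable_iter.
exact: measure_iter.
Qed.

Lemma bsumS g n x : bsum g n.+1 x = g x + bsum g n (f x).
Proof.
rewrite /bsum big_ord_recl; congr (_ + _); apply: eq_bigr => i _.
by rewrite -iterSr.
Qed.

Lemma bsumD g m n x : bsum g (m + n) x = bsum g m x + bsum g n (iter m f x).
Proof.
elim: m x => [|m IH] x; first by rewrite /bsum big_ord0 add0r.
by rewrite addSn !bsumS IH addrA -iterSr.
Qed.

Lemma bsum_ge0 g n x : (forall y, 0 <= g y) -> 0 <= bsum g n x.
Proof. by move=> g0; apply: sumr_ge0 => i _. Qed.

Lemma le_bsum g m n x : (forall y, 0 <= g y) -> (m <= n)%N ->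
  bsum g m x <= bsum g n x.
Proof.
move=> g0 mn; rewrite -(subnKC mn) bsumD lerDl; exact: bsum_ge0.
Qed.

Lemma measurable_bsum g n : measurable_fun [set: T] g ->
  measurable_fun [set: T] (bsum g n).
Proof.
move=> mg; apply: measurable_sum => k.
by apply: (measurableT_comp mg); exact: measurable_iter.
Qed.

Section Maximal.
Variables (g : T -> R) (lam : R).
Hypotheses (mg : measurable_fun [set: T] g) (g0 : forall x, 0 <= g x).
Hypothesis lam0 : 0 < lam.

Definition exceed (K : nat) : set T :=
  [set x | exists N, (0 < N <= K)%N /\ lam * N%:R < bsum g N x].

(* Each visit to [exceed K] opens a block on which the average of [g] exceeds [lam]. *)
Lemma bsum_exceed_le K n x : lam * bsum (\1_(exceed K)) n x <= bsum g (n + K) x.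
Proof.
elim/ltn_ind: n x => -[|n] IH x.
  by rewrite {1}/bsum big_ord0 mulr0; exact: bsum_ge0.
have [[N [/andP[N0 NK] hN]]|nx] := pselect (exceed K x); last first.
  rewrite bsumS addSn bsumS indicE memNset// add0r.
  by rewrite (le_trans (IH n _ _))// lerDr.
have le1 m y : bsum \1_(exceed K) m y <= m%:R.
  rewrite /bsum -[leRHS](_ : \sum_(k < m) 1 = _); last first.
    by rewrite sumr_const card_ord.
  by apply: ler_sum => i _; rewrite indicE; case: (_ \in _).
have [Nn|nN] := leqP N n.+1; last first.
  apply: (@le_trans _ _ (lam * N%:R)).
    rewrite ler_pM2l//; apply: (le_trans (le1 _ _)).
    by rewrite ler_nat ltnW.
  apply: (le_trans (ltW hN)); apply: le_bsum => //; lia.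
rewrite -{1}(subnKC Nn) bsumD.
have -> : (n.+1 + K = N + ((n.+1 - N) + K))%N by lia.
rewrite (bsumD g) mulrDr; apply: lerD.
  by apply: le_trans (ltW hN); rewrite ler_pM2l.
by apply: IH; lia.
Qed.

Lemma measurable_exceed K : measurable (exceed K).
Proof.
have -> : exceed K = \bigcup_(N in [set N | (0 < N <= K)%N])
    [set x | lam * N%:R < bsum g N x].
  apply/seteqP; split => x /=; first by move=> [N [? ?]]; exists N.
  by move=> [N ? ?]; exists N.
apply: bigcup_measurable => N _.
by apply: measurable_set_lt => //; exact: measurable_bsum.
Qed.

(** Integrating [bsum_exceed_le] and using invariance gives n lam mu(exceed K) <= (n + K) c, with c
    the integral of [g]. If c < lam mu(exceed K), this fails as soon as n exceeds K c / (lam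
    mu(exceed K) - c). *)
Lemma maximal_exceed K : (lam%:E * mu (exceed K) <= \int[mu]_x (g x)%:E)%E.
Proof.
have mE := measurable_exceed K.
have mgE : measurable_fun [set: T] (EFin \o g).
  exact/measurable_EFinP.
set c := (\int[mu]_x (g x)%:E)%E.
have c0 : (0 <= c)%E by apply: integral_ge0 => x _; rewrite lee_fin.
have mufin : mu (exceed K) \is a fin_num by exact: fin_num_measure.
have key n : (n%:R%:E * (lam%:E * mu (exceed K)) <= (n + K)%:R%:E * c)%E.
  have intb (h : T -> R) m : measurable_fun [set: T] h -> (forall x, 0 <= h x) ->
      (\int[mu]_x (bsum h m x)%:E = m%:R%:E * \int[mu]_x (h x)%:E)%E.
    move=> mh h0.
    have mhE : measurable_fun [set: T] (EFin \o h).
      exact/measurable_EFinP.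
    under eq_integral => x _ do rewrite /bsum -sumEFin.
    rewrite (ge0_integral_sum mu measurableT
        (f := fun (k : 'I_m) x => (h (iter k f x))%:E)); last 2 first.
    - move=> k; exact: (measurableT_comp mhE (measurable_iter k)).
    - by move=> k x _; rewrite lee_fin.
    under eq_bigr => k _ do
      rewrite (@ge0_integral_iter k (fun x => (h x)%:E)) //.
    elim: m => [|m IH]; first by rewrite big_ord0 mul0e.
    by rewrite big_ord_recr /= IH -natr1 EFinD ge0_muleDl ?mul1e ?lee_fin.
  have m1 : measurable_fun [set: T] (\1_(exceed K) : T -> R).
    exact: measurable_indic.
  have -> : (n%:R%:E * (lam%:E * mu (exceed K)) =
      \int[mu]_x (lam * bsum (\1_(exceed K)) n x)%:E)%E.
    under eq_integral => x _ do rewrite EFinM.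
    rewrite ge0_integralZl_EFin//; last 3 first.
    - by move=> x _; rewrite lee_fin bsum_ge0.
    - by apply/measurable_EFinP; exact: measurable_bsum.
    - exact: ltW.
    by rewrite intb// integral_indic// setIT muleCA.
  rewrite -intb//; apply: ge0_le_integral => //.
  - by move=> x _; rewrite lee_fin mulr_ge0 ?(ltW lam0)// bsum_ge0.
  - apply/measurable_EFinP.
    exact: (measurable_funM (measurable_cst _) (measurable_bsum _ _ _)).
  - by apply/measurable_EFinP; exact: measurable_bsum.
  - by move=> x _; rewrite lee_fin; exact: bsum_exceed_le.
case: c key c0 => [c||] key //= c0; last exact: leey.
move: key.
rewrite lee_fin in c0; rewrite -(fineK mufin).
set a := fine _ => key.
rewrite -EFinM lee_fin leNgt; apply/negP => lt_c.
have d0 : 0 < lam * a - c by rewrite subr_gt0.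
pose n := (Num.truncn (K%:R * c / (lam * a - c))).+1.
have := key n; rewrite -!EFinM lee_fin natrD.
have : K%:R * c / (lam * a - c) < n%:R by exact: truncnS_gt.
rewrite ltr_pdivrMr// => h1 h2; nra.
Qed.

Lemma maximal_ergodic :
  (lam%:E * mu (\bigcup_K exceed K) <= \int[mu]_x (g x)%:E)%E.
Proof.
have mE := measurable_exceed.
have cv : (mu \o exceed) x @[x --> \oo] --> mu (\bigcup_n exceed n).
  apply: nondecreasing_cvg_mu => //; first exact: bigcup_measurable.
  move=> m n mn; apply/subsetPset => x [N [/andP[N0 Nm] ?]].
  by exists N; rewrite N0 (leq_trans Nm mn).
have cv2 : (lam%:E * mu (exceed n))%E @[n --> \oo] -->
    (lam%:E * mu (\bigcup_n exceed n))%E by apply: cvgeZl.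
rewrite -(cvg_lim _ cv2)//; apply: lime_le; first by apply/cvg_ex; eexists; exact: cv2.
by apply: nearW => n; exact: maximal_exceed.
Qed.

End Maximal.
End MeasurePreserving.

Lemma rat_between {R : realType} (x y : \bar R) : (x < y)%E ->
  exists q : rat, (x < (ratr q)%:E < y)%E.
Proof.
have fin (r s : R) : r < s -> exists q : rat, r < ratr q < s.
  by move=> /rat_in_itvoo[q]; rewrite in_itv /=; exists q.
move: x y => [r||] [s||] //=.
- by rewrite lte_fin => /fin[q]; exists q; rewrite !lte_fin.
- move=> _; have [|q /andP[q1 _]] := fin r (r + 1); first by rewrite ltrDl.
  by exists q; rewrite lte_fin q1 ltry.
- move=> _; have [|q /andP[_ q1]] := fin (s - 1) s; first by rewrite gtrBl.
  by exists q; rewrite lte_fin q1 ltNyr.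
- by move=> _; exists 0; rewrite ltry ltNyr.
Qed.

(** * Kingman's theorem for a process subadditive on a forward invariant set of full measure *)

Section Kingman.
Context {d : measure_display} {T : measurableType d} {R : realType}.
Variables (mu : probability T R) (f : T -> T).
Hypothesis mf : measurable_fun [set: T] f.
Hypothesis finv : forall E, measurable E -> mu (f @^-1` E) = mu E.
Variables (X : nat -> T -> R) (K : R) (b : T -> R) (G : set T).
Hypothesis mX : forall n, measurable_fun [set: T] (X n).
Hypothesis mb : measurable_fun [set: T] b.
Hypothesis b0 : forall x, 0 <= b x.
Hypothesis bint : (\int[mu]_x (b x)%:E < +oo)%E.
Hypotheses (mG : measurable G) (muG : mu (~` G) = 0%E).
Hypothesis fG : forall x, G x -> G (f x).
Hypothesis X0 : forall x, X 0 x <= K.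
Hypothesis X1 : forall x, G x -> X 1 x <= b x.
Hypothesis Xsub : forall m n x, G x -> X (m + n) x <= X m x + X n (iter m f x).

Let iterG k x : G x -> G (iter k f x).
Proof. by move=> Gx; elim: k => //= k; exact: fG. Qed.

Section Level.
Variable al : R.

(** The charge for a step outside the tiles: [b] bounds the increment of [X], and [|al|] compensates
    the extra [al] in the main term, which may be negative. *)
Let g x := b x + `|al|.
Let g0 x : 0 <= g x. Proof. by rewrite addr_ge0. Qed.
Let mg : measurable_fun [set: T] g.
Proof. exact: (measurable_funD mb (measurable_cst _)). Qed.

(** The clause [L%:R < g x] caps the charge at [L] on all other points. Near the end of the window,
    where a tile may stick out, at most [L] steps are charged in this way, which costs at most
    L^2. *)
Definition untiled (L : nat) : set T :=
  [set x | (forall n, (0 < n <= L)%N -> al * n%:R < X n x) \/ L%:R < g x].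

Lemma measurable_untiled L : measurable (untiled L).
Proof.
have -> : untiled L = (\bigcap_(n in [set n | (0 < n <= L)%N])
    [set x | al * n%:R < X n x]) `|` [set x | L%:R < g x] by [].
apply: measurableU; last exact: measurable_set_lt.
by apply: bigcap_measurableType => // n _; exact: measurable_set_lt.
Qed.

(* Greedy tiling of [0, N): a block of length at most [L] on which the average
   of [X] is at most [al], or a single step charged to [untiled L]. *)
Lemma tiling_bound L N x : G x ->
  X N x <= N%:R * al + bsum f (fun y => g y * \1_(untiled L) y) N x
           + L%:R * (minn N L)%:R + K.
Proof.
set h := (fun y => _).
have h0 y : 0 <= h y by rewrite mulr_ge0 // indicE; case: (_ \in _).
have al_le : - `|al| <= al by rewrite lerNl -normrN ler_norm.
elim/ltn_ind: N x => -[|N] IH x Gx.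
  rewrite /bsum big_ord0 min0n mulr0 mul0r !add0r; exact: X0.
have Nmin : (minn N L <= minn N.+1 L)%N by lia.
have step : X N.+1 x <= b x + X N (f x).
  by rewrite -add1n; apply: (le_trans (Xsub _ _ _ Gx)); rewrite lerD2r; exact: X1.
have stepN := IH N (ltnSn N) (f x) (fG _ Gx).
have [Ux|nUx] := pselect (untiled L x).
  rewrite bsumS {1}/h indicE mem_set// mulr1 /g.
  have : L%:R * (minn N L)%:R <= L%:R * (minn N.+1 L)%:R :> R.
    by rewrite ler_wpM2l ?ler_nat.
  have EN : N.+1%:R = N%:R + 1 :> R by rewrite natr1.
  rewrite EN; lra.
have [n [/andP[n1 nL] Xn]] : exists n, (0 < n <= L)%N /\ X n x <= al * n%:R.
  apply: contrapT => H; apply: nUx; left => n nL.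
  by rewrite ltNge; apply/negP => Hn; apply: H; exists n.
have gL : g x <= L%:R.
  by rewrite leNgt; apply/negP => Hg; apply: nUx; right.
have [nN|Nn] := leqP n N.+1.
  have Gn := iterG n x Gx.
  have IHn := IH (N.+1 - n)%N ltac:(lia) (iter n f x) Gn.
  have Xs : X N.+1 x <= X n x + X (N.+1 - n)%N (iter n f x).
    by rewrite -{1}(subnKC nN); exact: Xsub.
  have Sn : bsum f h N.+1 x = bsum f h n x + bsum f h (N.+1 - n) (iter n f x).
    by rewrite -bsumD subnKC.
  have S0 := bsum_ge0 f h n x h0.
  have -> : N.+1%:R = n%:R + (N.+1 - n)%:R :> R by rewrite -natrD subnKC.
  have : L%:R * (minn (N.+1 - n) L)%:R <= L%:R * (minn N.+1 L)%:R :> R.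
    by rewrite ler_wpM2l// ler_nat; lia.
  lra.
have e1 : minn N.+1 L = N.+1 by lia.
have e2 : minn N L = N by lia.
rewrite e1; rewrite e2 in stepN.
have Sn := bsumS f h N x.
have := h0 x; rewrite /g in gL.
have EN : N.+1%:R = N%:R + 1 :> R by rewrite natr1.
rewrite EN; lra.
Qed.

(** The set where liminf X_n / n < al, written with countable quantifiers. The gap 1/(m+1) leaves
    room for the cost of one step of [f]. *)
Definition low : set T :=
  [set x | exists m, forall M, exists n, (M <= n)%N /\
    X n x <= n%:R * (al - m.+1%:R^-1)].

Lemma measurable_low : measurable low.
Proof.
have -> : low = \bigcup_m \bigcap_M \bigcup_(n in [set n | (M <= n)%N])
    [set x | X n x <= n%:R * (al - m.+1%:R^-1)].
  apply/seteqP; split => x /= [m].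
    by move=> H; exists m => // M _; have [n [? ?]] := H M; exists n.
  by move=> _ H; exists m => M; have [n ? ?] := H M I; exists n.
apply: bigcup_measurable => m _; apply: bigcap_measurableType => // M _.
by apply: bigcup_measurable => n _; exact: measurable_set_le.
Qed.

Lemma low_preimage x : G x -> low (f x) -> low x.
Proof.
move=> Gx [m H]; exists m.+1 => M.
pose e : R := m.+1%:R^-1 - m.+2%:R^-1.
have e0 : 0 < e by rewrite subr_gt0 ltf_pV2 ?posrE// ltr_nat.
(* The gap shrinks by [e], and [e * n] has to pay for [b x], caused by the added step, and for one
   further copy of al - 1/(m+2), bounded by |al| + 1. *)
pose M' := maxn M (Num.truncn ((b x + `|al| + 1) / e)).+1.
have [n [nM Xn]] := H M'.
exists n.+1; split; first by rewrite (leq_trans _ (leqW nM))// leq_maxl.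
have step : X n.+1 x <= b x + X n (f x).
  by rewrite -add1n; apply: (le_trans (Xsub _ _ _ Gx)); rewrite lerD2r; exact: X1.
have : b x + `|al| + 1 < e * n%:R.
  rewrite -ltr_pdivrMl// mulrC; apply: (lt_le_trans (truncnS_gt _)).
  by rewrite ler_nat (leq_trans _ nM)// leq_maxr.
have al_le : - `|al| <= al by rewrite lerNl -normrN ler_norm.
have : 0 < m.+2%:R^-1 :> R by rewrite invr_gt0.
have : m.+2%:R^-1 <= 1 :> R by rewrite invf_le1// ler1n.
have EN : n.+1%:R = n%:R + 1 :> R by rewrite natr1.
rewrite /e EN; move: Xn; move: (_^-1) (m.+2%:R^-1) => c1 c2 Xn.
move: (X n.+1 x) (X n (f x)) step Xn => u v; move: (n%:R) => N.
move: (b x) `|al| al_le => B A hA h1 h2 h3 h4 h5; lra.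
Qed.

(** Up to the null complement of [G], the preimage of [low] is contained in [low]; both have the
    same measure, so almost no point of [low] ever leaves it. *)
Lemma ae_low_orbit : {ae mu, forall x, low x -> forall k, low (iter k f x)}.
Proof.
have mL := measurable_low.
have mfL : measurable (f @^-1` low).
  by rewrite -[X in measurable X]setTI; exact: mf.
have null : mu (low `\` (f @^-1` low)) = 0%E.
  have muLG : mu (f @^-1` low `&` G) = mu low.
    have E := measureDI mu mfL mG.
    rewrite -(finv _ mL); apply: esym; apply: (eq_trans E).
    rewrite [X in (X + _)%E](_ : _ = 0%E) ?add0e//.
    apply/eqP; rewrite eq_le measure_ge0 andbT -muG; apply: le_measure; rewrite ?inE.
    - exact: measurableD.
    - exact: measurableC.
    - by move=> x [].
  apply/eqP; rewrite eq_le measure_ge0 andbT.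
  apply: (@le_trans _ _ (mu (low `\` (f @^-1` low `&` G)))).
    rewrite le_measure ?inE//; first exact: measurableD.
      by apply: measurableD => //; exact: measurableI.
    by move=> x [Lx nL]; split => // -[].
  rewrite measureD//; last 2 first.
  - exact: measurableI.
  - by rewrite -ge0_fin_numE// fin_num_measure.
  have -> : low `&` (f @^-1` low `&` G) = f @^-1` low `&` G.
    by apply/seteqP; split => x; [move=> []|move=> [? ?]; split => //; exact: low_preimage].
  rewrite [X in (_ - X)%E](muLG : _ = _) subee//; exact: fin_num_measure.
suff : {ae mu, forall x, forall k, low (iter k f x) -> low (iter k.+1 f x)}.
  apply: filterS => x H Lx; elim => // k; exact: H.
apply: ae_foralln => k.
exists (iter k f @^-1` (low `\` (f @^-1` low))); split.
- by rewrite -[X in measurable X]setTI; apply: measurable_iter => //; exact: measurableD.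
- by rewrite -null; apply: measure_iter => //; exact: measurableD.
- by move=> x /not_implyP[].
Qed.

(** Each point of [low] has a tile, so [h L] tends to 0 pointwise, and its integral does too by
    domination by [g]. By the maximal inequality almost every point has some [L] for which all
    Birkhoff averages of [h L] are at most [e]. On an orbit that stays in [low], these averages are
    the error of [tiling_bound]; the other half of be - al absorbs L^2 + K. *)
Lemma ae_low_upper be : al < be -> {ae mu, forall x, low x ->
  exists M, forall n, (M <= n)%N -> X n x <= n%:R * be}.
Proof.
move=> albe; pose e := (be - al) / 2.
have e0 : 0 < e by rewrite divr_gt0// subr_gt0.
pose h L y := g y * \1_(untiled L `&` low) y.
have h0 L y : 0 <= h L y by rewrite mulr_ge0 // indicE; case: (_ \in _).
have mUL L : measurable (untiled L `&` low).
  by apply: measurableI; [exact: measurable_untiled|exact: measurable_low].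
have mh L : measurable_fun [set: T] (h L).
  by apply: measurable_funM => //; exact: measurable_indic.
pose E L := \bigcup_k exceed f (h L) e k.
have mE L : measurable (E L).
  by apply: bigcup_measurable => k _; exact: measurable_exceed.
have gint : (\int[mu]_x (g x)%:E < +oo)%E.
  under eq_integral => x _ do rewrite EFinD.
  rewrite ge0_integralD//; last 2 first.
  - by move=> x _; rewrite lee_fin.
  - exact/measurable_EFinP.
  rewrite integral_cst// [X in (_ + _ * X)%E](probability_setT mu : _ = _) mule1.
  by rewrite lte_add_pinfty// ltry.
have cvI : (\int[mu]_x (h L x)%:E)%E @[L --> \oo] --> 0%E.
  rewrite -(integral0 mu [set: T]).
  apply: (@dominated_cvg _ _ _ mu _ measurableT (fun L x => (h L x)%:E) _
    (fun x => (g x)%:E)) => //.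
  - by move=> L; apply/measurable_EFinP.
  - move=> x _; apply: cvg_near_cst.
    have [Lx|nLx] := pselect (low x); last first.
      apply: nearW => L; rewrite /h indicE memNset ?mulr0//.
      by move=> [].
    have [m /(_ 1%N)[n [n1 Xn]]] := Lx.
    exists (maxn n (Num.truncn (g x)).+1) => // L /= HL.
    rewrite /h indicE memNset ?mulr0// => -[Hu _]; case: Hu => Hu.
      have nL : (0 < n <= L)%N by rewrite n1 (leq_trans (leq_maxl _ _) HL).
      have := Hu n nL; apply/negP; rewrite -leNgt (le_trans Xn)// mulrC.
      by rewrite ler_wpM2r// gerBl invr_ge0.
    move: Hu; apply/negP; rewrite -leNgt (le_trans (ltW (truncnS_gt _)))//.
    by rewrite ler_nat (leq_trans (leq_maxr _ _) HL).
  - apply/integrableP; split; first exact/measurable_EFinP.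
    by under eq_integral => x _ do rewrite gee0_abs ?lee_fin//.
  - move=> L x _; rewrite gee0_abs ?lee_fin//; exact: ler_piMr.
have null : mu (\bigcap_L E L) = 0%E.
  have mI : measurable (\bigcap_L E L) by exact: bigcap_measurableType.
  apply/eqP; rewrite eq_le measure_ge0 andbT.
  rewrite -(@pmule_rle0 _ e%:E) ?lte_fin//.
  rewrite -(cvg_lim _ cvI)//; apply: lime_ge; first by apply/cvg_ex; eexists; exact: cvI.
  apply: nearW => L.
  apply: le_trans (maximal_ergodic mu f mf finv (h L) e (mh L) (h0 L) e0).
  rewrite lee_pmul2l ?lte_fin//; apply: le_measure; rewrite ?inE//.
    by apply: bigcup_measurable => k _; exact: measurable_exceed.
  by move=> x /(_ L); apply.
have aeG : {ae mu, forall x, G x}.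
  by exists (~` G); split => //; exact: measurableC.
have aeI : {ae mu, forall x, ~ (\bigcap_L E L) x}.
  exists (\bigcap_L E L); split => //; first exact: bigcap_measurableType.
  by move=> x /contrapT.
apply: filterS3 aeG aeI ae_low_orbit => x Gx nE orb Lx.
apply: contrapT => H; apply: nE => L _.
pose M := maxn 1%N (Num.truncn ((L%:R * L%:R + `|K|) / e)).+1.
have [N [MN XN]] : exists N, (M <= N)%N /\ N%:R * be < X N x.
  apply: contrapT => H2; apply: H; exists M => n Mn.
  by rewrite leNgt; apply/negP => H3; apply: H2; exists n.
exists N => //; exists N; split.
  by rewrite leqnn andbT (leq_trans _ MN)// leq_maxl.
have := tiling_bound L N x Gx.
have -> : bsum f (fun y => g y * \1_(untiled L) y) N x = bsum f (h L) N x.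
  apply: eq_bigr => k _; rewrite /h !indicE in_setI.
  by rewrite [iter k f x \in low]mem_set ?andbT//; exact: orb.
have : L%:R * (minn N L)%:R <= L%:R * L%:R :> R.
  by rewrite ler_wpM2l// ler_nat; lia.
have : L%:R * L%:R + `|K| < e * N%:R.
  rewrite -ltr_pdivrMl// mulrC; apply: (lt_le_trans (truncnS_gt _)).
  by rewrite ler_nat (leq_trans _ MN)// leq_maxr.
have := ler_norm K.
have Ebe : be = al + 2 * e by rewrite /e mulrC divfK// addrC subrK.
rewrite Ebe in XN; lra.
Qed.

End Level.

(** If liminf < limsup, put rationals q1 < q2 < q3 strictly between them. The gap from q1 to q2
    places the point in [low] at level q2, and [ae_low_upper] then forces limsup <= q3. Rational
    levels keep the exceptional sets countable in number. *)
Theorem subadditive_ergodic : {ae mu, forall x, exists l : \bar R,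
  (X n x / n%:R)%:E @[n --> \oo] --> l}.
Proof.
have H : {ae mu, forall x, forall (q : rat), forall (p : rat), q < p ->
    low (ratr q) x -> exists M, forall n, (M <= n)%N -> X n x <= n%:R * ratr p}.
  have rq (P : rat -> T -> Prop) : (forall q, {ae mu, forall x, P q x}) ->
      {ae mu, forall x, forall q, P q x}.
    move=> HP; pose P' n x := if unpickle n is Some q then P q x else True.
    have H : {ae mu, forall x, forall n, P' n x}.
      apply: ae_foralln => n; rewrite /P'.
      by case: (unpickle n) => [q|]; [exact: HP|exact: aeW].
    by apply: filterS H => x Hx q; have := Hx (pickle q); rewrite /P' pickleK.
  apply: (rq) => q; apply: (rq) => p.
  have [qp|qp] := ltP q p; last by exact: aeW.
  have lt : (ratr q : R) < ratr p by rewrite ltr_rat.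
  by apply: filterS (ae_low_upper _ _ lt) => x Hx _.
apply: filterS H => x Hx.
pose u n := (X n x / n%:R)%:E.
exists (limn_einf u).
suff E : (limn_esup u <= limn_einf u)%E.
  apply: (@squeeze_cvge _ _ _ _ (einfs u) u (esups u)).
  - apply: nearW => n; apply/andP; split.
      by apply: ereal_inf_lbound; exists n => /=.
    by apply: ereal_sup_ubound; exists n => /=.
  - by rewrite limn_einf_lim; exact: is_cvg_einfs.
  - have <- : limn_esup u = limn_einf u by apply/eqP; rewrite eq_le E limn_einf_sup.
    by rewrite limn_esup_lim; exact: is_cvg_esups.
have einfE : limn_einf u = ereal_sup (range (einfs u)).
  by rewrite limn_einf_lim; apply: cvg_lim => //; exact: cvg_einfs_sup.
have esupE : limn_esup u = ereal_inf (range (esups u)).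
  by rewrite limn_esup_lim; apply: cvg_lim => //; exact: cvg_esups_inf.
rewrite leNgt; apply/negP => /rat_between[q1 /andP[infq1 /rat_between[q2]]].
move=> /andP[q12 /rat_between[q3 /andP[q23 q3sup]]].
rewrite !lte_fin !ltr_rat in q12 q23.
have [|M HM] := Hx q2 q3 q23.
  pose e : R := ratr q2 - ratr q1.
  have e0 : 0 < e by rewrite subr_gt0 ltr_rat.
  exists (Num.truncn e^-1) => M.
  have : (einfs u (maxn M 1) < (ratr q1)%:E)%E.
    by apply: le_lt_trans infq1; rewrite einfE; apply: ereal_sup_ubound; exists (maxn M 1).
  move=> /ereal_inf_lt[_ [n /= Mn <-]]; rewrite lte_fin => un.
  have n0 : (0 < n)%N by rewrite (leq_trans _ Mn)// leq_maxr.
  exists n; split; first by rewrite (leq_trans _ Mn)// leq_maxl.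
  have : (Num.truncn e^-1).+1%:R^-1 <= e.
    by rewrite invf_ple ?posrE//; exact/ltW/truncnS_gt.
  move: un; rewrite ltr_pdivrMr ?ltr0n// /e => un le_e.
  by apply: (le_trans (ltW un)); rewrite mulrC ler_wpM2l// lerBrDr addrC -lerBrDr.
have : (limn_esup u <= (ratr q3)%:E)%E.
  rewrite esupE; apply: (@le_trans _ _ (esups u (maxn M 1))).
    by apply: ereal_inf_lbound; exists (maxn M 1).
  apply: ge_ereal_sup => _ [n /= Mn <-]; rewrite lee_fin.
  have n0 : (0 < n)%N by rewrite (leq_trans _ Mn)// leq_maxr.
  rewrite ler_pdivrMr ?ltr0n// mulrC; apply: HM.
  by rewrite (leq_trans _ Mn)// leq_maxl.
by apply/negP; rewrite -ltNge.
Qed.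
End Kingman.

(** * Shannon-McMillan-Breiman theorem *)

(** Turns an integral of a countably valued function into a sum over its values. The code [c]
    expresses countability of [S], so that [S] needs no sigma-algebra of its own. *)
Lemma integral_fibers {d} {T : measurableType d} {R : realType}
    (mu : probability T R) (S : choiceType) (c : S -> nat) (h : T -> S)
    (D : set T) (F : S -> \bar R) :
  injective c -> (forall s, measurable (h @^-1` [set s])) -> measurable D ->
  (forall s, 0 <= F s)%E ->
  (\int[mu]_(x in D) F (h x) =
   \esum_(s in [set: S]) (F s * mu (D `&` h @^-1` [set s])))%E.
Proof.
move=> cinj mh mD F0.
pose J k := c @^-1` [set k].
pose Dk k := D `&` [set x | c (h x) = k].
have JE s : J (c s) = [set s].
  by apply/seteqP; split => t //=; [move/cinj|move=> ->].
have JP k : (exists s, c s = k) \/ J k = set0.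
  have [[s sk]|nk] := pselect (exists s, c s = k); first by left; exists s.
  by right; apply/seteqP; split => // s sk; apply: nk; exists s.
have DkE s : Dk (c s) = D `&` h @^-1` [set s].
  apply/seteqP; split => x [Dx /= hs]; split => //=; first exact: cinj.
  by rewrite hs.
have Dk0 k : J k = set0 -> Dk k = set0.
  move=> J0; apply/seteqP; split => // x [_ hk].
  by have : J k (h x) by []; rewrite J0.
have mDk k : measurable (Dk k).
  case: (JP k) => [[s <-]|/Dk0 -> //]; rewrite DkE; exact: measurableI.
have mF : measurable_fun [set: T] (fun x => F (h x)).
  move=> _ Y mY; rewrite setTI.
  have -> : (fun x => F (h x)) @^-1` Y = \bigcup_k
      [set x | c (h x) = k /\ Y (F (h x))].
    apply/seteqP; split => x /=; first by move=> Yx; exists (c (h x)).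
    by move=> [k _ []].
  apply: bigcup_measurable => k _.
  case: (JP k) => [[s <-]|J0].
    have [Ys|nYs] := pselect (Y (F s)).
      suff -> : [set x | c (h x) = c s /\ Y (F (h x))] = h @^-1` [set s] by [].
      by apply/seteqP; split => x /=; [move=> [/cinj]|move=> ->].
    suff -> : [set x | c (h x) = c s /\ Y (F (h x))] = set0 by [].
    by apply/seteqP; split => x //= [/cinj ->].
  suff -> : [set x | c (h x) = k /\ Y (F (h x))] = set0 by [].
  apply/seteqP; split => x //= [hk _].
  by have : J k (h x) by []; rewrite J0.
have DU : D = \bigcup_k Dk k.
  by apply/seteqP; split => x; [move=> Dx; exists (c (h x))|move=> [k _ []]].
rewrite {1}DU ge0_integral_bigcup//; last 2 first.
- exact: measurable_funTS.
- by move=> i j _ _ [x [[_ <-] [_ <-]]].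
have -> : [set: S] = \bigcup_(k in [set: nat]) J k.
  by apply/seteqP; split => s // _; exists (c s).
rewrite esum_bigcupT//; last 2 first.
- by move=> i j _ _ [x [<- <-]].
- by move=> x; rewrite mule_ge0.
rewrite nneseries_esumT; last first.
  by move=> k; apply: integral_ge0 => x _.
apply: eq_esum => k _; case: (JP k) => [[s <-]|J0].
  rewrite JE DkE esum_set1 ?mule_ge0//.
  under eq_integral => x /[!inE] -[_ /= ->] do over.
  by rewrite integral_cst//; exact: measurableI.
by rewrite J0 Dk0// esum_set0 integral_set0.
Qed.

(** * Words, cylinders and measurability *)

Section Words.
Context {I : pointedType}.
Hypothesis hI : countable [set: I].

(** Indexing cylinders by lists allows summing over words and concatenating them. *)
Definition cylseq (u : seq I) : set (Iseq I) := [set x | mkseq x (size u) = u].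

Lemma cyl_cylseq (w : nat -> I) n : cyl w n = cylseq (mkseq w n).
Proof.
rewrite /cylseq size_mkseq; apply/seteqP; split => x /=.
  by move=> H; apply/eq_in_map => i; rewrite mem_iota add0n => /H.
move=> H l ln; have := congr1 (fun s => nth point s l) H.
by rewrite !nth_mkseq.
Qed.

Lemma measurable_cyl (w : nat -> I) n : measurable (cyl w n : set (Iseq I)).
Proof. by apply: sub_sigma_algebra; exists w, n. Qed.

Lemma seq_code : exists c : seq I -> nat, injective c.
Proof.
have /countable_injP[g ginj] := hI.
exists (fun u => pickle (map g u)); apply: inj_comp.
  exact: (pcan_inj pickleK).
by apply: inj_map => i j; apply: ginj; rewrite inE.
Qed.

(** There are only countably many words, so a union of cylinders is a countable one. Preimages of
    balls and all sets determined by finitely many letters are treated this way. *)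
Lemma measurable_cyl_open (E : set (Iseq I)) :
  (forall w, E w -> exists n, cyl w n `<=` E) -> measurable E.
Proof.
move=> HE; have [c cinj] := seq_code.
pose V k := \bigcup_(u in [set u : seq I | c u = k /\ cylseq u `<=` E]) cylseq u.
have -> : E = \bigcup_k V k.
  apply/seteqP; split => x.
    move=> Ex; have [n sub] := HE _ Ex.
    exists (c (mkseq x n)) => //; exists (mkseq x n).
      by split => //; rewrite -cyl_cylseq.
    by rewrite -cyl_cylseq.
  by move=> [k _ [u [_ sub] /sub]].
apply: bigcup_measurable => k _.
have [[u [uk us]]|nu] := pselect (exists u, c u = k /\ cylseq u `<=` E); last first.
  have -> : V k = set0 => //.
  by apply/seteqP; split => // x [u ? _]; apply: nu; exists u.
have -> : V k = cylseq u.
  apply/seteqP; split => x; last by move=> ux; exists u.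
  by move=> [v [vk _]]; rewrite (cinj v u)// vk uk.
have [[x ux]|nx] := pselect (exists x, cylseq u x); last first.
  have -> : cylseq u = set0 by apply/seteqP; split => // x ux; apply: nx; exists x.
  exact: measurable0.
suff -> : cylseq u = cyl x (size u) by exact: measurable_cyl.
by rewrite cyl_cylseq ux.
Qed.

Lemma measurable_mkseq n (W : set (seq I)) :
  measurable ([set x | W (mkseq x n)] : set (Iseq I)).
Proof.
apply: measurable_cyl_open => w Ww; exists n => x.
by rewrite cyl_cylseq /cylseq /= size_mkseq => ->.
Qed.

Lemma measurable_fun_mkseq {R : realType} n (F : seq I -> R) :
  measurable_fun [set: Iseq I] (fun x : Iseq I => F (mkseq x n)).
Proof. by move=> _ Y mY; rewrite setTI; exact: (measurable_mkseq n (F @^-1` Y)). Qed.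

Lemma iter_sshift k (w : nat -> I) : iter k sshift w = fun l => w (l + k)%N.
Proof.
elim: k => [|k IH] /=; first by apply/funext => l; rewrite addn0.
by rewrite IH /sshift; apply/funext => l; rewrite addSnnS.
Qed.

Lemma measurable_sshift : measurable_fun [set: Iseq I] (@sshift I : Iseq I -> Iseq I).
Proof.
apply: (@measurability _ _ (Iseq I) (Iseq I) setT _ (@cylinders I)) => //.
move=> _ [C [w [n ->]] <-]; rewrite setTI.
apply: measurable_cyl_open => x /= Hx; exists n.+1 => y Hy l ln.
by rewrite -Hx// /sshift Hy.
Qed.

Lemma mkseqD (x : nat -> I) m n :
  mkseq x (m + n) = mkseq x m ++ mkseq (iter m sshift x) n.
Proof.
rewrite /mkseq iotaD map_cat add0n; congr (_ ++ _).
rewrite iter_sshift -{1}[m]addn0 iotaDl -map_comp; apply: eq_map => i /=.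
by rewrite addnC.
Qed.

End Words.

Lemma esumZl_le {R : realType} {T : choiceType} (D : set T) (c : R)
    (a : T -> \bar R) : 0 <= c -> (forall i, 0 <= a i)%E ->
  (\esum_(i in D) (c%:E * a i) <= c%:E * \esum_(i in D) a i)%E.
Proof.
move=> c0 a0; apply: ge_ereal_sup => _ [X [finX XD] <-].
rewrite -ge0_mule_fsumr//; apply: lee_wpmul2l; first by rewrite lee_fin.
by apply: ereal_sup_ubound; exists X.
Qed.

(** * The supermultiplicative majorant of the cylinder masses *)

Section SMB.
Context {I : pointedType} {R : realType}.
Hypothesis hI : countable [set: I].
Variable mu : probability (Iseq I) R.

Definition mw (u : seq I) : R := fine (mu (cylseq u)).

Lemma measurable_cylseq u : measurable (cylseq u : set (Iseq I)).
Proof. exact: (measurable_mkseq hI (size u) [set v | v = u]). Qed.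

Lemma mwE u : mu (cylseq u) = (mw u)%:E.
Proof. by rewrite fineK// fin_num_measure//; exact: measurable_cylseq. Qed.

Lemma mw_ge0 u : 0 <= mw u. Proof. exact: fine_ge0. Qed.

Lemma mw_nil : mw [::] = 1.
Proof.
have E : @cylseq I [::] = setT by apply/seteqP; split.
by rewrite /mw E [X in fine X](probability_setT mu : _ = _).
Qed.

Lemma mw_le1 u : mw u <= 1.
Proof. by rewrite -lee_fin -mwE; apply: probability_le1; exact: measurable_cylseq. Qed.

Lemma cylseq_rcons (v : seq I) (a : I) :
  cylseq (rcons v a) = cylseq v `&` [set x | x (size v) = a].
Proof.
rewrite /cylseq; apply/seteqP; split => x /=; rewrite size_rcons mkseqS.
  by move/rcons_inj => -[-> ->].
by move=> [-> ->].
Qed.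

Lemma esum_mw_rcons v : \esum_(a in [set: I]) (mw (rcons v a))%:E = (mw v)%:E.
Proof.
have /countable_injP[c cinj] := hI.
have cinj' : injective c by move=> i j; apply: cinj; rewrite inE.
have mh (a : I) : measurable ((fun x : Iseq I => x (size v)) @^-1` [set a]).
  apply: (measurable_cyl_open hI) => w /= wa; exists (size v).+1 => x Hx.
  by rewrite /= Hx.
have := integral_fibers mu _ c _ (cylseq v) (fun=> 1%E) cinj' mh
  (measurable_cylseq v) (fun=> lee01).
rewrite integral_cst ?mul1e; last exact: measurable_cylseq.
rewrite -mwE => ->; apply: eq_esum => a _.
by rewrite mul1e -mwE cylseq_rcons.
Qed.

Definition words n : set (seq I) := [set u | size u = n].

Lemma integral_words n (F : seq I -> \bar R) : (forall u, 0 <= F u)%E ->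
  (\int[mu]_x F (mkseq x n) = \esum_(u in words n) (F u * (mw u)%:E))%E.
Proof.
move=> F0; have [c cinj] := seq_code hI.
have mh u : measurable ((fun x : Iseq I => mkseq x n) @^-1` [set u]).
  exact: (measurable_mkseq hI n [set v | v = u]).
rewrite (integral_fibers mu _ c (fun x : Iseq I => mkseq x n) _ F cinj mh measurableT F0).
rewrite [RHS]esum_mkcond; apply: eq_esum => u _; rewrite setTI.
case: ifPn => [|nu].
  rewrite inE => un; rewrite -mwE; congr (_ * mu _)%E.
  by rewrite /cylseq un.
rewrite (_ : _ @^-1` _ = set0) ?measure0 ?mule0//.
apply/seteqP; split => // x /= xu.
by move: nu; rewrite notin_setE; apply; rewrite -xu /words /= size_mkseq.
Qed.

Lemma esum_words0 (F : seq I -> \bar R) : (forall u, 0 <= F u)%E ->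
  \esum_(u in words 0) F u = F [::].
Proof.
move=> F0; rewrite (_ : words 0 = [set [::]]) ?esum_set1//.
by apply/seteqP; split => u /=; [move/size0nil|move=> ->].
Qed.

Lemma esum_wordsS n (F : seq I -> \bar R) : (forall u, 0 <= F u)%E ->
  \esum_(u in words n.+1) F u =
  \esum_(a in [set: I]) \esum_(u in words n) F (a :: u).
Proof.
move=> F0; rewrite esum_esum//.
apply: (reindex_esum _ _ (fun k : I * seq I => k.1 :: k.2)); split.
- by move=> [a u] [_ un]; rewrite /words /= un.
- by move=> [a u] [b v] _ _ /= [-> ->].
- by move=> [//|a u] [un]; exists (a, u).
Qed.

(** For k > 0 this is 1/k - 1/(k+1), so the weights from k on add up to 1/k; this tail is the
    constant in [esum_hull]. *)
Definition renewal (k : nat) : R := (k%:R * k.+1%:R)^-1.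

(* Sum over the ways of cutting [v ++ u] into blocks, with [v] inside the first
   one, of the product of the weights [renewal l * mw block]. *)
Fixpoint hull (v u : seq I) : R :=
  match u with
  | [::] => renewal (size v) * mw v
  | a :: u' => hull (rcons v a) u' + renewal (size v) * mw v * hull [:: a] u'
  end.

Definition block_mass (u : seq I) : R :=
  if u is a :: u' then hull [:: a] u' else 1.

Lemma renewal_ge0 k : 0 <= renewal k.
Proof. by rewrite invr_ge0 mulr_ge0. Qed.

Lemma hull_ge0 v u : 0 <= hull v u.
Proof.
elim: u v => [|a u IH] v /=; first by rewrite mulr_ge0 ?renewal_ge0 ?mw_ge0.
by rewrite addr_ge0// !mulr_ge0 ?renewal_ge0 ?mw_ge0.
Qed.

Lemma block_mass_ge0 u : 0 <= block_mass u.
Proof. by case: u => [|a u] //=; exact: hull_ge0. Qed.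

(** Keep only the term without any cut. *)
Lemma le_hull v u : renewal (size v + size u) * mw (v ++ u) <= hull v u.
Proof.
elim: u v => [|a u IH] v /=; first by rewrite addn0 cats0.
rewrite -cat_rcons addnS -addSn -(size_rcons v a).
by apply: (le_trans (IH _)); rewrite lerDl !mulr_ge0 ?renewal_ge0 ?mw_ge0 ?hull_ge0.
Qed.

Lemma le_block_mass u : (0 < size u)%N ->
  renewal (size u) * mw u <= block_mass u.
Proof. by case: u => [//|a u] _ /=; exact: (le_hull [:: a] u). Qed.

(** The left side collects exactly the cuttings that cut at the junction; the remaining terms are
    nonnegative. *)
Lemma hull_cat w u b v :
  hull w u * hull [:: b] v <= hull w (u ++ b :: v).
Proof.
elim: u w => [|a u IH] w /=; first by rewrite lerDr hull_ge0.
rewrite mulrDl lerD// -mulrA ler_wpM2l// mulr_ge0 ?renewal_ge0 ?mw_ge0//.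
Qed.

Lemma block_mass_cat u v : block_mass u * block_mass v <= block_mass (u ++ v).
Proof.
case: u => [|a u]; first by rewrite mul1r.
case: v => [|b v]; first by rewrite mulr1 cats0.
exact: hull_cat.
Qed.

(** The open block [v], of length k, either grows by a letter, contributing 1/(k+1) after summation
    over that letter, or closes with weight 1/(k(k+1)), and the continuation from a fresh letter has
    total at most 1. The two add up to 1/k. *)
Lemma esum_hull n v : (0 < size v)%N ->
  (\esum_(u in words n) (hull v u)%:E <= ((size v)%:R^-1 * mw v)%:E)%E.
Proof.
have h0 w u : (0 <= (hull w u)%:E)%E by rewrite lee_fin hull_ge0.
elim: n v => [|n IH] v v0.
  rewrite esum_words0// lee_fin /= ler_wpM2r ?mw_ge0//.
  by rewrite /renewal invfM ler_piMr ?invr_ge0// invf_le1 ?ler1n.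
rewrite esum_wordsS//=.
set c := renewal (size v) * mw v.
have c0 : 0 <= c by rewrite mulr_ge0 ?renewal_ge0 ?mw_ge0.
apply: (@le_trans _ _ (\esum_(a in [set: I])
    ((size v).+1%:R^-1%:E * (mw (rcons v a))%:E + c%:E * (mw [:: a])%:E))%E).
  apply: le_esum => a _.
  under eq_esum => u _ do rewrite EFinD.
  rewrite esumD; last 2 first.
  - by move=> u _.
  - by move=> u _; rewrite lee_fin mulr_ge0 ?hull_ge0.
  apply: leeD.
    by rewrite -EFinM -(size_rcons v a); apply: IH; rewrite size_rcons.
  under eq_esum => u _ do rewrite EFinM.
  apply: (le_trans (esumZl_le _ _ _ c0 _)) => //.
  apply: lee_wpmul2l; first by rewrite lee_fin.
  by have := IH [:: a] isT; rewrite invr1 mul1r.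
have m0 u : (0 <= (mw u)%:E)%E by rewrite lee_fin mw_ge0.
have i0 : 0 <= (size v).+1%:R^-1 :> R by rewrite invr_ge0.
rewrite esumD; last 2 first.
- by move=> a _; rewrite -EFinM lee_fin mulr_ge0 ?mw_ge0.
- by move=> a _; rewrite -EFinM lee_fin mulr_ge0 ?mw_ge0.
apply: (le_trans (leeD (esumZl_le _ _ _ i0 _) (esumZl_le _ _ _ c0 _))) => //.
rewrite esum_mw_rcons (esum_mw_rcons [::]) mw_nil -!EFinM -EFinD lee_fin mulr1.
rewrite /c /renewal -mulrDl ler_wpM2r ?mw_ge0//.
have k0 : (size v)%:R != 0 :> R by rewrite pnatr_eq0 -lt0n.
have k1 : (size v).+1%:R != 0 :> R by rewrite pnatr_eq0.
rewrite -natr1 in k1 *; rewrite le_eqVlt; apply/orP; left; apply/eqP.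
by field; rewrite k1 k0.
Qed.

Lemma esum_block_mass n :
  (\esum_(u in words n) (block_mass u)%:E <= 1)%E.
Proof.
have b0 u : (0 <= (block_mass u)%:E)%E by rewrite lee_fin block_mass_ge0.
case: n => [|n]; first by rewrite esum_words0.
rewrite esum_wordsS//=; apply: (@le_trans _ _ (\esum_(a in [set: I]) (mw [:: a])%:E)).
  apply: le_esum => a _.
  by have := esum_hull n [:: a] isT; rewrite invr1 mul1r.
by rewrite (esum_mw_rcons [::]) mw_nil.
Qed.

End SMB.

Lemma borel_cantelli_ae {d} {T : measurableType d} {R : realType}
    (mu : probability T R) (F : nat -> set T) (v : nat -> R) (C : R) :
  (forall n, measurable (F n)) -> (forall n, mu (F n) <= (v n)%:E)%E ->
  (forall N, \sum_(n < N) v n <= C) ->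
  {ae mu, forall x, exists M, forall n, (M <= n)%N -> ~ F n x}.
Proof.
move=> mF Fv vC; exists (lim_sup_set F); split.
- by apply: bigcap_measurableType => n _; exact: bigcup_measurable.
- apply: lim_sup_set_cvg0 => //; apply: (le_lt_trans _ (ltry C)).
  apply: lime_le; first exact: is_cvg_nneseries.
  apply: nearW => N; rewrite big_mkord.
  apply: (@le_trans _ _ (\sum_(n < N) (v n)%:E)%E).
    by apply: lee_sum => i _; exact: Fv.
  by rewrite sumEFin lee_fin.
- move=> x /= H n _; apply: contrapT => H2; apply: H; exists n => m nm Fm.
  by apply: H2; exists m.
Qed.

Lemma cvg_average_close {R : realType} (a b : nat -> R) (l : \bar R) :
  (forall e, 0 < e -> exists M, forall n, (M <= n)%N -> `|b n - a n| <= e * n%:R) ->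
  (a n / n%:R)%:E @[n --> \oo] --> l -> (b n / n%:R)%:E @[n --> \oo] --> l.
Proof.
move=> H al.
have z : ((b n - a n) / n%:R) @[n --> \oo] --> (0 : R).
  apply/cvgrPdist_le => e e0; have [M HM] := H e e0.
  exists M => // n /= Mn; rewrite sub0r normrN normrM normfV (ger0_norm (ler0n _ n)).
  have [->|n0] := posnP n; first by rewrite invr0 mulr0 ltW.
  by rewrite ler_pdivrMr ?ltr0n//; exact: HM.
have -> : (fun n => (b n / n%:R)%:E) =
    (fun n => (a n / n%:R)%:E + ((b n - a n) / n%:R)%:E)%E.
  by apply/funext => n; rewrite -EFinD -mulrDl addrC subrK.
rewrite -[l]adde0; apply: cvgeD => //; last by apply: cvg_EFin => //; exact: nearW.
by rewrite fin_num_adde_defl.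
Qed.

Lemma ln_poly_le {R : realType} (e : R) : 0 < e -> exists M, forall n, (M <= n)%N ->
  ln (n.+1%:R * n.+2%:R) <= e * n%:R.
Proof.
move=> e0; pose e3 := e / 3; have e30 : 0 < e3 by rewrite divr_gt0.
(* With x = e n / 3, exp(3 x) >= x^3, and the threshold makes x^3 >= 6 n^2, which is at least
   (n+1)(n+2) for n >= 1. *)
exists (maxn 1 (Num.truncn (6 / e3 ^+ 3)).+1) => n Mn.
have n1 : 1 <= n%:R :> R by rewrite ler1n (leq_trans _ Mn)// leq_maxl.
have nb : 6 <= e3 ^+ 3 * n%:R.
  rewrite -ler_pdivrMl ?exprn_gt0// mulrC; apply: (le_trans (ltW (truncnS_gt _))).
  by rewrite ler_nat (leq_trans _ Mn)// leq_maxr.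
rewrite -[leRHS]expRK ler_ln ?posrE ?mulr_gt0 ?ltr0n ?expR_gt0//.
have -> : e * n%:R = 3%:R * (e3 * n%:R) by rewrite /e3; field.
rewrite expRM_natl.
apply: (@le_trans _ _ ((e3 * n%:R) ^+ 3)); last first.
  have en0 : 0 <= e3 * n%:R by rewrite mulr_ge0// ltW.
  have le1 : e3 * n%:R <= expR (e3 * n%:R).
    by apply: (@le_trans _ _ (1 + e3 * n%:R)); [rewrite lerDr|exact: expR_ge1Dx].
  by apply: lerXn2r; rewrite ?nnegrE ?expR_ge0.
rewrite exprMn exprS (exprS _ 1) expr1 -!natr1.
have : 6 * (n%:R * n%:R) <= e3 ^+ 3 * n%:R * (n%:R * n%:R).
  by rewrite ler_wpM2r// mulr_ge0.
rewrite [in X in _ -> X]mulrA; nra.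
Qed.

Section SMBTheorem.
Context {I : pointedType} {R : realType}.
Hypothesis hI : countable [set: I].
Variable mu : probability (Iseq I) R.
Hypothesis hinv : forall E : set (Iseq I), measurable E ->
  mu (@sshift I @^-1` E) = mu E.
Hypothesis hent : (hmu mu < +oo)%E.

Local Notation mw := (mw mu).

Lemma measure_words n (W : set (seq I)) :
  mu [set x | W (mkseq x n)] =
  (\esum_(u in words n) ((\1_W u)%:E * (mw u)%:E))%E.
Proof.
have mW := measurable_mkseq hI n W.
rewrite -(integral_words hI mu n (fun u => (\1_W u)%:E)).
  have E := integral_indic mu measurableT mW; rewrite setIT in E.
  apply: (eq_trans (esym E)).
  by apply: eq_integral => x _; rewrite !indicE; congr (_%:R%:E); apply/idP/idP; rewrite !inE.
by move=> u; rewrite lee_fin.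
Qed.

(** Only here do logarithms of cylinder masses have their meaning; this is the forward invariant set
    of full measure to which Kingman's theorem is applied. *)
Definition positive_cyl : set (Iseq I) := [set x | forall n, 0 < mw (mkseq x n)].

Lemma measurable_positive_cyl : measurable positive_cyl.
Proof.
have -> : positive_cyl = \bigcap_n [set x | 0 < mw (mkseq x n)].
  by apply/seteqP; split => x H n => [_|]; exact: H.
by apply: bigcap_measurableType => n _; exact: (measurable_mkseq hI n [set u | 0 < mw u]).
Qed.

Lemma measure_positive_cylC : mu (~` positive_cyl) = 0%E.
Proof.
have mF n : measurable [set x : Iseq I | mw (mkseq x n) = 0].
  exact: (measurable_mkseq hI n [set u | mw u = 0]).
apply/eqP; rewrite eq_le measure_ge0 andbT.
have H : mu.-negligible (\bigcup_n [set x : Iseq I | mw (mkseq x n) = 0]).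
  apply: negligible_bigcup => n; apply/negligibleP => //.
  apply: (eq_trans (measure_words n [set u | mw u = 0])); apply: esum1 => u _.
  rewrite indicE; have [|] := boolP (u \in _); last by rewrite mul0e.
  by rewrite inE /= => ->; rewrite mule0.
suff /negligibleS/(_ H)[N [mN N0 sub]] : ~` positive_cyl `<=`
    \bigcup_n [set x : Iseq I | mw (mkseq x n) = 0]; last first.
  move=> x /= /existsNP[n /negP]; rewrite -leNgt => le0; exists n => //=.
  by apply/eqP; rewrite eq_le le0 mw_ge0.
rewrite -N0; apply: le_measure; rewrite ?inE//.
by apply: measurableC; exact: measurable_positive_cyl.
Qed.

Lemma ae_positive_cyl : {ae mu, forall x, positive_cyl x}.
Proof.
exists (~` positive_cyl); split => //; last exact: measure_positive_cylC.
by apply: measurableC; exact: measurable_positive_cyl.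
Qed.

Lemma mw_cat_le (u v : seq I) : mw (u ++ v) <= mw u.
Proof.
rewrite -lee_fin -!(mwE hI); apply: le_measure; rewrite ?inE; try exact: measurable_cylseq.
move=> x; rewrite /cylseq /= size_cat mkseqD => /eqP.
by rewrite eqseq_cat ?size_mkseq// => /andP[/eqP].
Qed.

Lemma mw_behead_le a (u : seq I) : mw (a :: u) <= mw u.
Proof.
rewrite -lee_fin -!(mwE hI) -(hinv (cylseq u)); last exact: measurable_cylseq.
have mu' : measurable ((@sshift I : Iseq I -> Iseq I) @^-1` cylseq u).
  by rewrite -[X in measurable X]setTI; apply: (measurable_sshift hI) => //; exact: measurable_cylseq.
apply: le_measure; rewrite ?inE//; first exact: measurable_cylseq.
move=> x; rewrite /cylseq /= -add1n mkseqD => -[_].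
by [].
Qed.

Lemma positive_cyl_sshift x : positive_cyl x -> positive_cyl (sshift x).
Proof.
move=> H n; apply: lt_le_trans (H n.+1) _.
by rewrite -add1n mkseqD; exact: mw_behead_le.
Qed.

Lemma Hn_words n :
  Hn mu n = \esum_(u in words n) (- ln (mw u) * mw u)%:E.
Proof.
rewrite (@reindex_esum _ (n.-tuple I) _ setT (words n) (@tval n I)); last first.
- split.
  + by move=> t _; rewrite /words /= size_tuple.
  + by move=> s t _ _ /val_inj.
  + by move=> u /= un; exists (Tuple (introT eqP un)).
- apply: eq_esum => t _; congr (_%:E).
  have -> : cylw t = cylseq (tval t).
    apply/seteqP; split => x; rewrite /cylseq /= size_tuple => H.
      apply: (@eq_from_nth _ point); first by rewrite size_mkseq size_tuple.
      move=> i; rewrite size_mkseq => i_n; rewrite nth_mkseq//.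
      by have := H (Ordinal i_n); rewrite (tnth_nth point).
    move=> l; rewrite (tnth_nth point) -H nth_mkseq//.
  by rewrite mulNr [mw _ * _]mulrC.
Qed.

Let lnmw_ge0 u : 0 <= - ln (mw u).
Proof. by rewrite oppr_ge0 ln_le0// mw_le1. Qed.

(** If every [Hn mu n] with n >= 1 were infinite, the sequence defining [hmu] would be constantly
    +oo from 1 on. So some [Hn mu n] is finite, and it dominates the information of the first letter
    because longer cylinders are smaller. *)
Lemma integral_information_lty : (\int[mu]_x (- ln (mw (mkseq x 1)))%:E < +oo)%E.
Proof.
have intE n : (\int[mu]_x (- ln (mw (mkseq x n)))%:E = Hn mu n)%E.
  rewrite (integral_words hI mu n (fun u => (- ln (mw u))%:E)) ?Hn_words//.
have [n [n0 Hn]] : exists n, (0 < n)%N /\ (Hn mu n < +oo)%E.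
  apply: contrapT => H; move: hent; rewrite /hmu ltNge => /negP; apply.
  suff -> : limn (fun n => Hn mu n * n%:R^-1%:E)%E = +oo%E by [].
  apply: cvg_lim => //; apply: cvg_near_cst; exists 1%N => // n /= n1.
  have -> : Hn mu n = +oo%E.
    by apply/eqP; rewrite eq_le leey leNgt; apply/negP => Hn; apply: H; exists n.
  by rewrite gt0_mulye// lte_fin invr_gt0 ltr0n.
apply: le_lt_trans Hn; rewrite -intE.
apply: ae_ge0_le_integral => //.
- by move=> x _; rewrite lee_fin.
- by apply/measurable_EFinP; exact: (measurable_fun_mkseq hI 1 (fun u => - ln (mw u))).
- by move=> x _; rewrite lee_fin.
- by apply/measurable_EFinP; exact: (measurable_fun_mkseq hI n (fun u => - ln (mw u))).
apply: filterS ae_positive_cyl => x Gx _.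
rewrite lee_fin lerN2 ler_ln ?posrE//.
by rewrite -(subnKC n0) mkseqD; exact: mw_cat_le.
Qed.

Theorem shannon_mcmillan_breiman :
  {ae mu, forall x, positive_cyl x /\ exists l : \bar R,
     (- ln (mw (mkseq x n)) / n%:R)%:E @[n --> \oo] --> l}.
Proof.
pose Q := block_mass mu.
pose X n (x : Iseq I) := - ln (Q (mkseq x n)).
(* [ln 2] is [- ln (renewal 1)], so [b] is the value of [X 1] on [positive_cyl]. *)
pose b (x : Iseq I) := - ln (mw (mkseq x 1)) + ln 2.
have Qpos n x : positive_cyl x -> 0 < Q (mkseq x n).
  move=> Gx; case: n => [|n]; first exact: ltr01.
  apply: lt_le_trans (le_block_mass mu _ _); last by rewrite size_mkseq.
  by rewrite mulr_gt0// size_mkseq invr_gt0 mulr_gt0.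
have ln2 : 0 <= ln 2 :> R by rewrite ln_ge0// ler1n.
have K : {ae mu, forall x, exists l : \bar R, (X n x / n%:R)%:E @[n --> \oo] --> l}.
  apply: (subadditive_ergodic mu (@sshift I : Iseq I -> Iseq I)
    (measurable_sshift hI) hinv X 0 b positive_cyl) => //.
  - by move=> n; exact: (measurable_fun_mkseq hI n (fun u => - ln (Q u))).
  - exact: (measurable_fun_mkseq hI 1 (fun u => - ln (mw u) + ln 2)).
  - by move=> x; rewrite addr_ge0.
  - under eq_integral => x _ do rewrite EFinD.
    rewrite ge0_integralD//; last 2 first.
      by move=> x _; rewrite lee_fin.
      by apply/measurable_EFinP; exact: (measurable_fun_mkseq hI 1 (fun u => - ln (mw u))).
    rewrite integral_cst// [X in (_ + _ * X)%E](probability_setT mu : _ = _) mule1.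
    by rewrite lte_add_pinfty ?ltry//; exact: integral_information_lty.
  - exact: measurable_positive_cyl.
  - exact: measure_positive_cylC.
  - exact: positive_cyl_sshift.
  - by move=> x; rewrite /X /= ln1 oppr0.
  - move=> x Gx; rewrite /X /b /Q /= /renewal /=.
    have := Gx 1%N; rewrite /mkseq /= => G1.
    by rewrite lnM ?posrE ?invr_gt0 ?mulr_gt0// lnV ?posrE ?mulr_gt0// mul1r opprD opprK addrC.
  - move=> m n x Gx; rewrite /X mkseqD -opprD lerN2.
    have Gm : positive_cyl (iter m sshift x).
      by elim: m => //= m; exact: positive_cyl_sshift.
    rewrite -lnM ?posrE ?Qpos// ler_ln ?posrE ?mulr_gt0 ?Qpos//.
      exact: block_mass_cat.
    by rewrite -mkseqD Qpos.
(* The words with mw u < v n * Q u have total mass at most [v n], since [Q] has total at most 1, and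
   the series of [v] telescopes. *)
pose v n : R := (n.+1%:R * n.+2%:R)^-1.
have v0 n : 0 < v n by rewrite invr_gt0 mulr_gt0.
have BC : {ae mu, forall x, exists M, forall n, (M <= n)%N ->
    ~ (mw (mkseq x n) < v n * Q (mkseq x n))}.
  apply: (borel_cantelli_ae mu (fun n => [set x | mw (mkseq x n) < v n * Q (mkseq x n)]) v 1).
  - by move=> n; exact: (measurable_mkseq hI n [set u | mw u < v n * Q u]).
  - move=> n; apply: (@le_trans _ _ (\esum_(u in words n) ((\1_[set u | mw u < v n * Q u] u)%:E * (mw u)%:E))%E).
      by rewrite le_eqVlt; apply/orP; left; apply/eqP; exact: (measure_words n [set u | mw u < v n * Q u]).
    apply: (@le_trans _ _ (\esum_(u in words n) ((v n)%:E * (Q u)%:E))%E).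
      apply: le_esum => u _; rewrite indicE -!EFinM lee_fin.
      have [|_] := boolP (u \in _); first by rewrite inE /= mul1r => /ltW.
      by rewrite mul0r mulr_ge0 ?(ltW (v0 n)) ?block_mass_ge0.
    apply: (le_trans (esumZl_le _ _ _ (ltW (v0 n)) _)).
      by move=> u; rewrite lee_fin block_mass_ge0.
    rewrite -[leRHS]mule1; apply: lee_wpmul2l; first by rewrite lee_fin ltW.
    exact: esum_block_mass.
  - move=> N; suff : \sum_(n < N) v n = 1 - N.+1%:R^-1.
      by move=> ->; rewrite gerBl invr_ge0.
    elim: N => [|N IH]; first by rewrite big_ord0 invr1 subrr.
    rewrite big_ord_recr /= IH /v.
    have n1 : N.+1%:R != 0 :> R by rewrite pnatr_eq0.
    have n2 : N.+2%:R != 0 :> R by rewrite pnatr_eq0.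
    rewrite -[N.+2%:R]natr1 in n2 *; move: n1 n2; move: (N.+1%:R) => k k0 k1.
    by field; rewrite k0 k1.
apply: filterS3 ae_positive_cyl K BC => x Gx [l Xl] [M HM]; split => //.
exists l; apply: cvg_average_close Xl => e e0.
have [M2 HM2] := ln_poly_le e e0.
exists (maxn 1 (maxn M M2)) => n; rewrite !geq_max => /and3P[n1 Mn M2n].
have Gn := Gx n; have Qn := Qpos n x Gx.
have pn : 0 < n.+1%:R * n.+2%:R :> R by rewrite mulr_gt0.
have lnle := HM2 n M2n.
have A : mw (mkseq x n) * (n.+1%:R * n.+2%:R) >= Q (mkseq x n).
  have /negP := HM n Mn; rewrite -leNgt /v => H.
  by rewrite -ler_pdivrMr// mulrC.
have B : mw (mkseq x n) <= Q (mkseq x n) * (n.+1%:R * n.+2%:R).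
  have := le_block_mass mu (mkseq x n); rewrite size_mkseq => /(_ n1).
  rewrite /renewal mulrC ler_pdivrMr; last by rewrite mulr_gt0 ?ltr0n.
  move=> H; apply: (le_trans H); rewrite ler_wpM2l ?(ltW Qn)// -!natrM ler_nat; lia.
rewrite /X opprK ler_norml; apply/andP; split.
  rewrite -subr_ge0.
  have := A; rewrite -ler_ln ?posrE ?mulr_gt0// lnM ?posrE// => A'.
  have := B; rewrite -ler_ln ?posrE ?mulr_gt0// lnM ?posrE// => B'.
  lra.
have := A; rewrite -ler_ln ?posrE ?mulr_gt0// lnM ?posrE// => A'.
lra.
Qed.

End SMBTheorem.

(** * Coding map and coverings *)

Lemma geometric_small {R : realType} (c C e : R) : 0 <= c -> c < 1 -> 0 < e ->
  exists m, C * c ^+ m < e.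
Proof.
move=> c0 c1 e0; have [C0|C0] := leP C 0.
  by exists 0; apply: le_lt_trans e0; rewrite expr0 mulr1.
have : c ^+ m @[m --> \oo] --> (0 : R) by apply: cvg_expr; rewrite ger0_norm.
move=> /cvgrPdist_lt/(_ (e / C)); rewrite divr_gt0// => /(_ isT)[m _ /(_ m)].
rewrite /= leqnn sub0r normrN ger0_norm ?exprn_ge0// => /(_ isT) H.
by exists m; rewrite mulrC -ltr_pdivlMr.
Qed.

Section Coding.
Context {R : realType} {I : pointedType} {d : nat}.
Variables (A : I -> 'M[R]_d) (a : I -> 'cV[R]_d) (Rad c : R).
Hypotheses (Rad0 : 0 < Rad) (c0 : 0 <= c) (c1 : c < 1).
Hypothesis Ac : forall i v, eucl (A i *m v) <= c * eucl v.
Hypothesis ARad : forall i x, eucl x <= Rad -> eucl (A i *m x + a i) <= Rad.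

Lemma wmx_le w n v : eucl (wmx A w n *m v) <= c ^+ n * eucl v.
Proof.
elim: n v => [|n IH] v /=; first by rewrite mul1mx mul1r.
rewrite -mulmxA; apply: le_trans (IH _) _.
by rewrite exprSr -mulrA ler_wpM2l ?exprn_ge0.
Qed.

Lemma fw_sub w n x y : fw A a w n x - fw A a w n y = wmx A w n *m (x - y).
Proof.
elim: n x y => [|n IH] x y /=; first by rewrite mul1mx.
by rewrite IH opprD addrACA subrr addr0 -mulmxBr mulmxA.
Qed.

Lemma fw_lip w n x y :
  eucl (fw A a w n x - fw A a w n y) <= c ^+ n * eucl (x - y).
Proof. by rewrite fw_sub; exact: wmx_le. Qed.

Lemma fw_stable w n x : eucl x <= Rad -> eucl (fw A a w n x) <= Rad.
Proof. by elim: n x => [|n IH] x xR //=; apply: IH; exact: ARad. Qed.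

Lemma fwD w n m x : fw A a w (n + m) x = fw A a w n (fw A a (iter n sshift w) m x).
Proof.
elim: m x => [|m IH] x; first by rewrite addn0.
by rewrite addnS /= IH (iter_sshift n w) addnC.
Qed.

Lemma wmxD w n m : wmx A w (n + m) = wmx A w n *m wmx A (iter n sshift w) m.
Proof.
elim: m => [|m IH]; first by rewrite addn0 mulmx1.
by rewrite addnS /= IH (iter_sshift n w) mulmxA addnC.
Qed.

Lemma fw_cyl w w' n x : cyl w n w' -> fw A a w' n x = fw A a w n x.
Proof.
elim: n x => [//|n IH] x H /=; rewrite H// IH// => l ln.
by apply: H; exact: ltnW.
Qed.

Lemma wmx_cyl w w' n : cyl w n w' -> wmx A w' n = wmx A w n.
Proof.
elim: n => [//|n IH] H /=; rewrite H// IH// => l ln.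
by apply: H; exact: ltnW.
Qed.

Let eucl_0_Rad : eucl (0 : 'cV[R]_d) <= Rad.
Proof. by rewrite eucl0 ltW. Qed.

(* The limit of [fw w m 0]: each coordinate minus the error bound [c ^+ m * Rad] is a
   lower bound of the limit, so the supremum of these converges to it. *)
Definition coding_lim (w : nat -> I) : 'cV[R]_d :=
  \col_k sup (range (fun m => fw A a w m 0 k ord0 - c ^+ m * Rad)).

Lemma fw_cauchy w m n : eucl (fw A a w (m + n) 0 - fw A a w m 0) <= c ^+ m * Rad.
Proof.
rewrite fwD; apply: le_trans (fw_lip _ _ _ _) _.
by rewrite subr0 ler_wpM2l ?exprn_ge0// fw_stable.
Qed.

Lemma coding_lim_coord w m k :
  `|coding_lim w k ord0 - fw A a w m 0 k ord0| <= c ^+ m * Rad.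
Proof.
pose v := fun m => fw A a w m 0 k ord0 - c ^+ m * Rad.
have ub n j : v n <= fw A a w j 0 k ord0 + c ^+ j * Rad.
  have cR i : 0 <= c ^+ i * Rad by rewrite mulr_ge0 ?exprn_ge0// ltW.
  have := cR n; have := cR j; rewrite /v.
  have [nj|/ltnW jn] := leqP n j.
    have := le_trans (coord_le_eucl _ _ k) (fw_cauchy w n (j - n)).
    by rewrite subnKC// !mxE ler_norml => /andP[]; lra.
  have := le_trans (coord_le_eucl _ _ k) (fw_cauchy w j (n - j)).
  by rewrite subnKC// !mxE ler_norml => /andP[]; lra.
rewrite mxE -/v ler_norml; apply/andP; split.
  rewrite lerBrDl -/(v m); apply: ub_le_sup; last by exists m.
  by exists (fw A a w m 0 k ord0 + c ^+ m * Rad) => _ [n _ <-]; exact: ub.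
rewrite lerBlDl; apply: ge_sup; first by exists (v 0); exists 0.
by move=> _ [n _ <-]; exact: ub.
Qed.

Lemma coding_lim_dist w m :
  eucl (coding_lim w - fw A a w m 0) <= d%:R * Rad * c ^+ m.
Proof.
apply: le_trans (eucl_le_sum _ _) _.
apply: (@le_trans _ _ (\sum_(k < d) c ^+ m * Rad)).
  by apply: ler_sum => k _; have := coding_lim_coord w m k; rewrite !mxE.
by rewrite sumr_const card_ord -[X in X <= _]mulr_natl mulrCA mulrC.
Qed.

Lemma coding_lim_Rad w : eucl (coding_lim w) <= Rad.
Proof.
rewrite leNgt; apply/negP; rewrite -subr_gt0 => gt.
have [m] := geometric_small c (d%:R * Rad) _ c0 c1 gt; apply/negP; rewrite -leNgt.
apply: le_trans (coding_lim_dist w m).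
have := eucl_triangle _ (coding_lim w - fw A a w m 0) (fw A a w m 0).
rewrite subrK; have := fw_stable w m 0 eucl_0_Rad; lra.
Qed.

(** For every m, both sides are within d Rad c^m of [fw A a w (n + m) 0]. *)
Lemma coding_lim_fw w n : coding_lim w = fw A a w n (coding_lim (iter n sshift w)).
Proof.
apply/eqP; rewrite -subr_eq0 -eucl_eq0 eq_le eucl_ge0 andbT leNgt.
apply/negP => gt.
have [m] := geometric_small c (d%:R * Rad + d%:R * Rad) _ c0 c1 gt; apply/negP; rewrite -leNgt.
apply: le_trans (eucl_dist_triangle _ (fw A a w (n + m) 0) _ _) _.
have cn1 : c ^+ n <= 1 by rewrite exprn_ile1// ltW.
have dR : 0 <= d%:R * Rad by rewrite mulr_ge0// ltW.
have dRm : 0 <= d%:R * Rad * c ^+ m by rewrite mulr_ge0// exprn_ge0.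
rewrite mulrDl; apply: lerD.
  apply: le_trans (coding_lim_dist _ _) _.
  by rewrite exprD mulrCA ler_piMl.
rewrite fwD; apply: le_trans (fw_lip _ _ _ _) _.
rewrite eucl_distC; apply: (@le_trans _ _ (1 * eucl (coding_lim (iter n sshift w) - fw A a (iter n sshift w) m 0))).
  by rewrite ler_wpM2r ?eucl_ge0.
by rewrite mul1r; exact: coding_lim_dist.
Qed.

(** [piA] is a chosen point of the nested intersection; [coding_lim] shows that the intersection is
    nonempty, so the choice does lie in it. *)
Lemma piA_fw w n : exists y, eucl y <= Rad /\ piA A a Rad w = fw A a w n y.
Proof.
rewrite /piA; set P := (X in xget 0 X).
have : P (xget 0 P).
  apply: xgetPex; exists (coding_lim w) => m; exists (coding_lim (iter m sshift w)).
  by split; [exact: coding_lim_Rad|exact: coding_lim_fw].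
exact.
Qed.

Lemma piA_cyl_dist w w' n : cyl w n w' ->
  eucl (piA A a Rad w' - piA A a Rad w) <= 2 * Rad * c ^+ n.
Proof.
move=> ww'; have [y [yR ->]] := piA_fw w n; have [y' [y'R ->]] := piA_fw w' n.
rewrite (fw_cyl w)//; apply: le_trans (fw_lip _ _ _ _) _.
rewrite mulrC ler_wpM2r ?exprn_ge0//; apply: le_trans (eucl_triangle _ _ _) _.
by rewrite euclN mulr_natl mulr2n lerD.
Qed.

Lemma piA_continuous w e : 0 < e -> exists n, forall w', cyl w n w' ->
  eucl (piA A a Rad w' - piA A a Rad w) < e.
Proof.
move=> e0; have [n ne] := geometric_small c (2 * Rad) e c0 c1 e0.
by exists n => w' ww'; apply: le_lt_trans ne; exact: piA_cyl_dist.
Qed.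

End Coding.

Section Covering.
Context {R : realType} {d : nat}.

(* Grid of mesh [rho] in the directions of the [k] longest axes. *)
Lemma ellipsoid_cover (M : 'M[R]_d) (s : 'rV[R]_d) (p : 'cV[R]_d) (Rad rho : R) (k : nat) :
  is_svd M s -> 0 < Rad -> 0 < rho ->
  (forall l : 'I_d, (l < k)%N -> rho <= s ord0 l) ->
  (forall l : 'I_d, (k <= l)%N -> s ord0 l <= rho) ->
  exists J : seq 'cV[R]_d,
    (size J)%:R <= \prod_(l < d | (l < k)%N) ((2 * Rad + 1) * (s ord0 l / rho)) /\
    forall y, eucl y <= Rad ->
      exists2 q, q \in J & eucl (M *m y + p - q) < (d%:R * (Rad + 1) + 1) * rho.
Proof.
move=> [_ [s0 [U [V [UU [VV ME]]]]]] R0 r0 big small.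
(* Grid points on a segment of length 2 Rad s_l. On a long axis s_l / rho >= 1, so the added 1 is
   absorbed and the count is at most (2 Rad + 1) s_l / rho. *)
pose n (l : 'I_d) := if (l < k)%N then (Num.truncn (2 * Rad * (s ord0 l / rho))).+1 else 1%N.
pose K : nat := (\sum_l n l)%N.
have nK l : (n l <= K)%N by rewrite /K (bigD1 l)//= leq_addr.
pose F (l : 'I_d) : pred 'I_K.+1 := mem [seq inord i : 'I_K.+1 | i <- iota 0 (n l)].
pose ctr (j : {ffun 'I_d -> 'I_K.+1}) : 'cV[R]_d :=
  \col_l (if (l < k)%N then (j l)%:R * rho - Rad * s ord0 l else 0).
exists [seq U *m ctr j + p | j <- enum (family F)]; split.
  rewrite size_map -cardE card_family.
  apply: (@le_trans _ _ (\prod_(l < d) (n l)%:R)).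
    rewrite foldrE big_map big_enum /= natr_prod; apply: ler_prod => l _.
    rewrite ler0n ler_nat /=; apply: leq_trans (card_size _) _.
    by rewrite size_map size_iota.
  rewrite (bigID (fun l : 'I_d => (l < k)%N)) /= [X in _ * X]big1 ?mulr1; last first.
    by move=> l lk; rewrite /n (negPf lk).
  apply: ler_prod => l lk; rewrite ler0n /= /n lk.
  have sr : 1 <= s ord0 l / rho by rewrite ler_pdivlMr// mul1r big.
  have h0 : 0 <= 2 * Rad * (s ord0 l / rho).
    by rewrite mulr_ge0 ?(le_trans ler01 sr)// mulr_ge0// ltW.
  have tle : (Num.truncn (2 * Rad * (s ord0 l / rho)))%:R <= 2 * Rad * (s ord0 l / rho).
    by rewrite truncn_le.
  rewrite -[_.+1%:R]natr1 [leRHS]mulrDl mul1r; exact: lerD.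
move=> y yR; pose z := V^T *m y.
have zR l : `|z l ord0| <= Rad.
  apply: le_trans (coord_le_eucl _ _ _) _.
  by rewrite /z eucl_orth// trmxK; exact: mulmx1C.
pose x l := s ord0 l * z l ord0.
have xs l : `|x l| <= Rad * s ord0 l.
  by rewrite normrM ger0_norm// mulrC ler_wpM2r.
pose t l := Num.truncn ((x l + Rad * s ord0 l) / rho).
pose j : {ffun 'I_d -> 'I_K.+1} := [ffun l : 'I_d => if (l < k)%N then inord (t l) else inord 0].
have tn (l : 'I_d) : (l < k)%N -> (t l < n l)%N.
  move=> lk; rewrite /n lk ltnS /t; apply: le_truncn.
  rewrite mulrA ler_wpM2r ?invr_ge0 ?(ltW r0)//.
  by have := xs l; rewrite ler_norml => /andP[]; lra.
exists (U *m ctr j + p).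
  apply/mapP; exists j => //; rewrite mem_enum; apply/familyP => l.
  rewrite /F /= ffunE; case: ifPn => lk.
    by apply/mapP; exists (t l) => //; rewrite mem_iota add0n tn.
  by apply/mapP; exists 0%N => //; rewrite mem_iota add0n /n (negPf lk).
have -> : M *m y + p - (U *m ctr j + p) = U *m (diag_mx s *m z - ctr j).
  by rewrite opprD addrACA subrr addr0 mulmxBr ME /z !mulmxA.
clearbody z.
rewrite eucl_orth//; apply: le_lt_trans (eucl_le_sum _ _) _.
(* Per coordinate the error is at most [rho] on a long axis and [Rad * rho] on a short one; the
   additional [rho] makes the inequality strict. *)
apply: (@le_lt_trans _ _ (\sum_(l < d) (Rad + 1) * rho)); last first.
  by rewrite sumr_const card_ord -[X in X < _]mulr_natl mulrA [X in _ < X]mulrDl mul1r ltrDl.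
apply: ler_sum => l _; rewrite mul_diag_mx !mxE -/(x l) ffunE.
have [lk|lk] := boolP (l < k)%N.
  have xl : 0 <= (x l + Rad * s ord0 l) / rho.
    by apply: divr_ge0; [have := xs l; rewrite ler_norml => /andP[]; lra|exact: ltW].
  rewrite inordK; last by rewrite ltnS (leq_trans _ (nK l))// ltnW// tn.
  have := truncn_itv xl; rewrite -/(t l) => /andP[t1 t2].
  have : (t l)%:R * rho <= x l + Rad * s ord0 l by rewrite -ler_pdivlMr.
  have : x l + Rad * s ord0 l < (t l).+1%:R * rho by rewrite -ltr_pdivrMr.
  rewrite -[_.+1%:R]natr1; move: ((t l)%:R) (x l) (s ord0 l) => tt xx ss h1 h2.
  have Rr : 0 <= Rad * rho by rewrite mulr_ge0 ?ltW.
  rewrite ler_norml; apply/andP; split; lra.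
rewrite subr0; apply: le_trans (xs l) _.
rewrite -leqNgt in lk; have := small l lk => h.
have : Rad * s ord0 l <= Rad * rho by rewrite ler_wpM2l// ltW.
lra.
Qed.

End Covering.

Lemma measure_bigsetU_le {d} {T : measurableType d} {R : realType}
    (mu : probability T R) (S : eqType) (s : seq S) (P : pred S) (A : S -> set T) (t : R) :
  (forall q, measurable (A q)) -> 0 <= t -> (forall q, P q -> mu (A q) <= t%:E)%E ->
  (mu (\big[setU/set0]_(q <- s | P q) A q) <= ((size s)%:R * t)%:E)%E.
Proof.
move=> mA t0 At; elim: s => [|q s IH]; first by rewrite big_nil measure0 mul0r.
rewrite big_cons /= -natr1 mulrDl mul1r; case: ifP => Pq.
  apply: le_trans (measureU2 _ _ _) _ => //; first exact: bigsetU_measurable.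
  by rewrite addrC EFinD leeD// At.
by apply: (le_trans IH); rewrite lee_fin lerDl.
Qed.

(** * Points whose ball has too little mass *)

Section BadSets.
Context {I : pointedType} {R : realType} {d : nat}.
Hypothesis hI : countable [set: I].
Variable mu : probability (Iseq I) R.
Variable p : (nat -> I) -> 'cV[R]_d.
Hypothesis p_continuous : forall w e, 0 < e ->
  exists n, forall w', cyl w n w' -> eucl (p w' - p w) < e.

Lemma p_ball_open w q r : eucl (p w - q) < r ->
  exists n, forall w', cyl w n w' -> eucl (p w' - q) < r.
Proof.
move=> wr; have [n Hn] := p_continuous w (r - eucl (p w - q)) ltac:(by rewrite subr_gt0).
exists n => w' /Hn H; apply: le_lt_trans (eucl_dist_triangle _ (p w) _ _) _; lra.
Qed.

Lemma measurable_p_ball q r :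
  measurable (p @^-1` [set y | eucl (y - q) < r] : set (Iseq I)).
Proof.
apply: (measurable_cyl_open hI) => w /p_ball_open[n Hn].
by exists n => w' /Hn.
Qed.

Definition ball_mass (x : 'cV[R]_d) (r : R) : R :=
  fine (mu (p @^-1` [set y | eucl (y - x) < r])).

Lemma ball_massE x r : mu (p @^-1` [set y | eucl (y - x) < r]) = (ball_mass x r)%:E.
Proof. by rewrite fineK// fin_num_measure//; exact: measurable_p_ball. Qed.

Lemma ball_mass_le x r r' : r <= r' -> ball_mass x r <= ball_mass x r'.
Proof.
move=> rr'; rewrite -lee_fin -!ball_massE; apply: le_measure.
- by apply: mem_set; exact: measurable_p_ball.
- by apply: mem_set; exact: measurable_p_ball.
by move=> w /= wr; exact: lt_le_trans rr'.
Qed.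

(** Cut [u] into the pieces lying over the covering balls and call a piece bad if its mass is below
    del mu[u] / N(u). There are at most N(u) pieces, so the bad ones in [u] have total mass at most
    del mu[u], and summing over words gives del. At any other point, a covering ball containing the
    projection carries a good piece and lies in the ball of twice the radius around that
    projection. *)
Lemma small_ball_exception n (J : seq I -> seq 'cV[R]_d) (r N : seq I -> R) (del : R) :
  0 <= del -> (forall u, 0 < N u) ->
  (forall x : nat -> I, (size (J (mkseq x n)))%:R <= N (mkseq x n)) ->
  (forall x : nat -> I, exists2 q, q \in J (mkseq x n) & eucl (p x - q) < r (mkseq x n)) ->
  exists F : set (Iseq I), [/\ measurable F, (mu F <= del%:E)%E &
    forall x : nat -> I, ~ F x -> del * mw mu (mkseq x n) / N (mkseq x n) <=
       ball_mass (p x) (2 * r (mkseq x n))].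
Proof.
move=> del0 N0 JN Jcov.
pose Bq u q : set (Iseq I) := p @^-1` [set y | eucl (y - q) < r u].
pose cap u q := cylseq u `&` Bq u q.
have mcap u q : measurable (cap u q).
  by apply: measurableI; [exact: measurable_cylseq|exact: measurable_p_ball].
pose thr u := del * mw mu u / N u.
have thr0 u : 0 <= thr u by rewrite divr_ge0 ?mulr_ge0 ?mw_ge0// ltW.
pose F : set (Iseq I) := [set x | exists2 q, q \in J (mkseq x n) &
  eucl (p x - q) < r (mkseq x n) /\ (mu (cap (mkseq x n) q) < (thr (mkseq x n))%:E)%E].
have mF : measurable F.
  apply: (measurable_cyl_open hI) => x [q qJ [xq lt]].
  have [m Hm] := p_ball_open _ _ _ xq.
  exists (maxn n m) => y Hy.
  have yx : mkseq y n = mkseq x n.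
    apply/eq_in_map => i; rewrite mem_iota add0n /= => i_n.
    by apply: Hy; rewrite leq_max i_n.
  by exists q; rewrite yx//; split => //; apply: Hm => l lm; apply: Hy; rewrite leq_max lm orbT.
exists F; split => //.
  have [c cinj] := seq_code hI.
  have mh u : measurable ((fun x : Iseq I => mkseq x n) @^-1` [set u]).
    exact: (measurable_mkseq hI n [set v | v = u]).
  have := integral_fibers mu _ c (fun x : Iseq I => mkseq x n) F (fun=> 1%E) cinj mh mF (fun=> lee01).
  rewrite integral_cst ?mul1e// => ->.
  apply: (@le_trans _ _ (\esum_(u in [set: seq I]) (if u \in words n then del%:E * (mw mu u)%:E else 0))%E).
    apply: le_esum => u _; rewrite mul1e.
    have [[x [Fx xu]]|nx] := pselect (exists x, (F `&` (fun x : Iseq I => mkseq x n) @^-1` [set u]) x); last first.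
      rewrite (_ : _ `&` _ = set0) ?measure0.
        by case: ifP => // _; rewrite mule_ge0// lee_fin// mw_ge0.
      by apply/seteqP; split => // x Hx; apply: nx; exists x.
    have un : u \in words n by apply: mem_set; rewrite /words /= -xu size_mkseq.
    rewrite un -EFinM.
    pose bad q := (mu (cap u q) < (thr u)%:E)%E.
    apply: (@le_trans _ _ (mu (\big[setU/set0]_(q <- J u | bad q) cap u q))).
      apply: le_measure.
      - by apply: mem_set; exact: measurableI.
      - by apply: mem_set; apply: bigsetU_measurable => q _; exact: mcap.
      - move=> y [[q qJ [yq lt]] yu]; rewrite /= in yu.
        rewrite yu in qJ yq lt.
        rewrite -bigcup_seq_cond; exists q; first by rewrite /= qJ.
        split => //; move/set_mem: un => un; rewrite /cylseq /=.
        by rewrite un.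
    have badle q : bad q -> (mu (cap u q) <= (thr u)%:E)%E by move=> /ltW.
    have B := measure_bigsetU_le mu _ (J u) bad (cap u) (thr u) (mcap u) (thr0 u) badle.
    apply: (le_trans B).
    rewrite lee_fin; apply: (@le_trans _ _ (N u * thr u)).
      by rewrite ler_wpM2r// -xu.
    by rewrite /thr mulrC divfK// gt_eqF.
  rewrite -esum_mkcond.
  apply: (le_trans (esumZl_le _ _ _ del0 _)); first by move=> u; rewrite lee_fin mw_ge0.
  rewrite -[leRHS]mule1; apply: lee_wpmul2l; first by rewrite lee_fin.
  have := integral_words hI mu n (fun=> 1%E) (fun=> lee01).
  rewrite integral_cst// [X in (_ * X)%E = _](probability_setT mu : _ = _) mule1 => ->.
  by apply: le_esum => u _; rewrite mul1e.
move=> x nFx; have [q qJ xq] := Jcov x.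
have le : ((thr (mkseq x n))%:E <= mu (cap (mkseq x n) q))%E.
  by rewrite leNgt; apply/negP => lt; apply: nFx; exists q.
rewrite -lee_fin -ball_massE; apply: (le_trans le).
apply: le_measure; first by apply: mem_set; exact: mcap.
  by apply: mem_set; exact: measurable_p_ball.
move=> y [_ /= yq]; apply: le_lt_trans (eucl_dist_triangle _ q _ _) _.
by rewrite mulr_natl mulr2n ltrD// eucl_distC.
Qed.

End BadSets.

(** * Local dimension *)

Section LocalDimension.
Context {I : pointedType} {R : realType} {d : nat}.
Hypothesis hI : countable [set: I].
Variable mu : probability (Iseq I) R.
Variable p : (nat -> I) -> 'cV[R]_d.
Hypothesis p_continuous : forall w e, 0 < e ->
  exists n, forall w', cyl w n w' -> eucl (p w' - p w) < e.

(** For r = e^{-L} take the first n with C e^{-nX} < r. Then n <= (ln C + L) / X + 1, so the ratio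
    is at most n kap / L, which tends to kap / X. *)
Lemma updimloc_le (x : 'cV[R]_d) (C X kap : R) (n0 : nat) :
  0 < C -> 0 < X -> 0 <= kap ->
  (forall n, (n0 <= n)%N -> expR (- (n%:R * kap)) <= ball_mass mu p x (C * expR (- (n%:R * X)))) ->
  (updimloc mu p x <= (kap / X)%:E)%E.
Proof.
move=> C0 X0 k0 H; apply/lee_addgt0Pr => e e0; rewrite -EFinD.
(* The summands ensure in turn that L and ln C + L are positive, that n >= n0, and that the lower
   order terms are at most e L. *)
pose L0 := 1 + `|ln C| + X * n0%:R + (kap * `|ln C| / X + kap) / e.
have q0 : 0 <= kap * `|ln C| / X by rewrite divr_ge0 ?mulr_ge0// ltW.
have q1 : 0 <= (kap * `|ln C| / X + kap) / e by rewrite divr_ge0 ?addr_ge0// ltW.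
have q2 : 0 <= X * n0%:R by rewrite mulr_ge0// ltW.
have L01 : 1 <= L0 by rewrite /L0; have := normr_ge0 (ln C); lra.
apply: (@le_trans _ _ (ereal_sup (locratio mu p x @` [set r : R | 0 < r < expR (- L0)]))).
  by apply: ereal_inf_lbound; exists (expR (- L0)) => //=; exact: expR_gt0.
apply: ge_ereal_sup => _ [r /= /andP[r0 rL] <-].
pose L := - ln r.
have LL0 : L0 < L.
  by rewrite /L ltrNr -[X in _ < X]expRK ltr_ln ?posrE ?expR_gt0.
have rE : r = expR (- L) by rewrite opprK lnK.
have L1 : 0 < L by lra.
have lnC : - `|ln C| <= ln C <= `|ln C| by rewrite -ler_norml.
pose n := (Num.truncn ((ln C + L) / X)).+1.
have CL0 : 0 <= (ln C + L) / X.
  apply: divr_ge0; last exact: ltW.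
  have := LL0; rewrite /L0; lra.
have nup : n%:R * X <= ln C + L + X.
  rewrite /n -natr1 mulrDl mul1r lerD2r -ler_pdivlMr//.
  by rewrite truncn_le.
have nlow : ln C + L < n%:R * X by rewrite -ltr_pdivrMr// truncnS_gt.
have n0n : (n0 <= n)%N.
  rewrite -(ler_nat R) -(ler_pM2r X0); apply: le_trans (ltW nlow).
  have := LL0; rewrite /L0; lra.
have mr : expR (- (n%:R * kap)) <= ball_mass mu p x r.
  apply: (le_trans (H n n0n)); apply: ball_mass_le => //.
  rewrite rE -{1}(lnK C0) -expRD ler_expR; lra.
have m0 : 0 < ball_mass mu p x r by apply: lt_le_trans mr; exact: expR_gt0.
(* Positive mass excludes the value +oo assigned to null balls. *)
rewrite /locratio ifF; last first.
  apply/negP => /eqP E; move: m0; rewrite /ball_mass.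
  by rewrite [X in fine X](_ : _ = 0%E) ?ltxx.
rewrite lee_fin -/(ball_mass mu p x r).
have lnr : ln r = - L by rewrite opprK.
rewrite lnr invrN mulrN -mulNr ler_pdivrMr//.
have lnm : - (n%:R * kap) <= ln (ball_mass mu p x r).
  by rewrite -[X in X <= _]expRK ler_ln ?posrE ?expR_gt0.
have : n%:R * kap <= (ln C + L + X) / X * kap.
  by rewrite ler_wpM2r// ler_pdivlMr.
have -> : (ln C + L + X) / X * kap = kap * ln C / X + kap / X * L + kap.
  by field; rewrite gt_eqF.
have : kap * ln C / X <= kap * `|ln C| / X.
  rewrite ler_wpM2r ?invr_ge0 ?(ltW X0)// ler_wpM2l//; exact: ler_norm.
have : (kap * `|ln C| / X + kap) < e * L.
  rewrite [X in _ < X]mulrC -ltr_pdivrMr//; have := LL0; rewrite /L0.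
  have := normr_ge0 (ln C); lra.
lra.
Qed.

End LocalDimension.

Lemma sum_expR_le {R : realType} (e : R) (N : nat) : 0 < e ->
  \sum_(n < N) expR (- (n%:R * e)) <= (1 - expR (- e))^-1.
Proof.
move=> e0; have q1 : expR (- e) < 1 by rewrite -expR0 ltr_expR oppr_lt0.
have q0 : 0 < 1 - expR (- e) by rewrite subr_gt0.
suff -> : \sum_(n < N) expR (- (n%:R * e)) = (1 - expR (- (N%:R * e))) / (1 - expR (- e)).
  by rewrite ler_piMl ?invr_ge0 ?ltW// gtrBl expR_gt0.
elim: N => [|N IH]; first by rewrite big_ord0 mul0r oppr0 expR0 subrr mul0r.
have EN : N.+1%:R * e = N%:R * e + e by rewrite -natr1 mulrDl mul1r.
rewrite big_ord_recr /= IH EN [- (_ + e)]opprD expRD.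
by field; rewrite gt_eqF.
Qed.

(** * Almost sure statements for singular values and ball masses *)

Section Process.
Context {I : pointedType} {R : realType} {d : nat}.
Hypothesis hI : countable [set: I].
Variables (A : I -> 'M[R]_d) (a : I -> 'cV[R]_d) (Rad c : R).
Hypothesis Ainv : forall i, A i \in unitmx.
Hypotheses (Rad0 : 0 < Rad) (c0 : 0 < c) (c1 : c < 1).
Hypothesis Ac : forall i v, eucl (A i *m v) <= c * eucl v.
Hypothesis ARad : forall i x, eucl x <= Rad -> eucl (A i *m x + a i) <= Rad.
Variable mu : probability (Iseq I) R.
Hypothesis hinv : forall E : set (Iseq I), measurable E ->
  mu (@sshift I @^-1` E) = mu E.

Let proj := piA A a Rad.
Let proj_continuous := piA_continuous A a Rad c Rad0 (ltW c0) c1 Ac ARad.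

Lemma wmx_unit w n : wmx A w n \in unitmx.
Proof. by elim: n => [|n IH] /=; [exact: unitmx1|rewrite unitmx_mul IH Ainv]. Qed.

(** Zero-based: [alp w n k] is alpha_{k+1}(w|_n), the first factor not included in [phik w n k]. *)
Definition alp (w : nat -> I) n l : R := alpha (wmx A w n) l.
Definition phik (w : nat -> I) n k : R := \prod_(l < k) alp w n l.

Lemma alp_gt0 w n l : (l < d)%N -> 0 < alp w n l.
Proof. by move=> ld; apply: alpha_gt0 => //; exact: wmx_unit. Qed.

Lemma alp_le w n l : alp w n l <= c ^+ n.
Proof.
apply: alpha_le; [exact: wmx_unit|by rewrite exprn_ge0// ltW|move=> v].
exact: (wmx_le _ _ (ltW c0) Ac).
Qed.

Lemma alp_le1 w n l : alp w n l <= 1.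
Proof. by apply: le_trans (alp_le w n l) _; rewrite exprn_ile1// ltW. Qed.

Lemma phik_gt0 w n k : (k <= d)%N -> 0 < phik w n k.
Proof. by move=> kd; apply: prod_alpha_gt0 => //; exact: wmx_unit. Qed.

Lemma phikS w n k : phik w n k.+1 = phik w n k * alp w n k.
Proof. by rewrite /phik big_ord_recr. Qed.

Lemma phik_mono w n j k : (j <= k <= d)%N -> phik w n k <= phik w n j.
Proof.
move=> /andP[/subnKC <-]; elim: (k - j)%N => [|i IH] jd; first by rewrite addn0.
rewrite addnS in jd *; rewrite phikS; apply: le_trans (IH (ltnW jd)).
by rewrite ler_piMr ?alp_le1// ltW// phik_gt0// ltnW.
Qed.

Lemma phik_le1 w n k : (k <= d)%N -> phik w n k <= 1.
Proof. by move=> kd; rewrite -[leRHS](_ : phik w n 0 = _) ?phik_mono// /phik big_ord0. Qed.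

Lemma measurable_fun_cyl (n : nat) (g : (nat -> I) -> R) :
  (forall w w', cyl w n w' -> g w' = g w) -> measurable_fun [set: Iseq I] (g : Iseq I -> R).
Proof.
move=> H _ Y mY; rewrite setTI; apply: (measurable_cyl_open hI) => w /= Yw.
by exists n => w' /H /= ->.
Qed.

(* Kingman's theorem applies to the submultiplicative norm, which is comparable to [phik]. *)
Lemma ae_lim_phik k : (k <= d)%N -> {ae mu, forall w : Iseq I, exists l : \bar R,
  (ln (phik w n k) / n%:R)%:E @[n --> \oo] --> l}.
Proof.
move=> kd.
pose Cst : R := @compound_const R d k.
pose X n (w : Iseq I) : R := ln (compound_norm k (wmx A w n)).
have Npos n w : 0 < compound_norm k (wmx A w n).
  by apply: compound_norm_gt0 => //; exact: wmx_unit.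
have up n w : compound_norm k (wmx A w n) <= Cst ^+ 3 * phik w n k.
  by apply: compound_norm_upper => //; exact: wmx_unit.
have low n w : phik w n k <= Cst ^+ 2 * compound_norm k (wmx A w n).
  by apply: compound_norm_lower => //; exact: wmx_unit.
have Cst0 : 0 <= Cst by apply: sumr_ge0 => f _; apply: sumr_ge0 => g _; exact: mulrn_wge0.
have Cpos : 0 < Cst.
  rewrite lt_def Cst0 andbT; apply/eqP => C0.
  have := lt_le_trans (phik_gt0 (fun=> point) 0 k kd) (low 0 (fun=> point)).
  by rewrite C0 expr0n mul0r ltxx.
have K : {ae mu, forall w, exists l : \bar R, (X n w / n%:R)%:E @[n --> \oo] --> l}.
  (* The empty product is the identity for every sequence, so [X 0] is constant. One step costs at
     most |ln (Cst^3)| because [phik] is at most 1. *)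
  apply: (subadditive_ergodic mu (@sshift I : Iseq I -> Iseq I)
    (measurable_sshift hI) hinv X (X 0 (fun=> point)) (fun=> `|ln (Cst ^+ 3)|) setT) => //.
  - move=> n; apply: (measurable_fun_cyl n (X n)) => w w' H.
    by rewrite /X (wmx_cyl _ w).
  - rewrite integral_cst// [X in (_ * X)%E](probability_setT mu : _ = _) mule1.
    exact: ltry.
  - by rewrite setCT measure0.
  - move=> w _; apply: le_trans (ler_norm _).
    rewrite ler_ln ?posrE ?exprn_gt0//; apply: le_trans (up _ _) _.
    by rewrite ler_piMr ?exprn_ge0// phik_le1.
  - move=> m n w _; rewrite /X -lnM ?posrE// ler_ln ?posrE ?mulr_gt0//.
    by rewrite wmxD; exact: compound_norm_mul.
apply: filterS K => w [l Xl]; exists l; apply: cvg_average_close Xl => e e0.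
pose B : R := `|ln (Cst ^+ 3)| + `|ln (Cst ^+ 2)|.
exists (Num.truncn (B / e)).+1 => n nB.
have Bn : B <= e * n%:R.
  rewrite mulrC -ler_pdivrMr//; apply: le_trans (ltW (truncnS_gt _)) _.
  by rewrite ler_nat.
apply: le_trans Bn; rewrite /X /B ler_norml; apply/andP.
have p0 := phik_gt0 w n k kd.
have := up n w; rewrite -ler_ln ?posrE ?mulr_gt0 ?exprn_gt0// lnM ?posrE ?exprn_gt0// => U.
have := low n w; rewrite -ler_ln ?posrE ?mulr_gt0 ?exprn_gt0// lnM ?posrE ?exprn_gt0// => Lo.
have := ler_norm (ln (Cst ^+ 3)); have := ler_norm (ln (Cst ^+ 2)).
have := normr_ge0 (ln (Cst ^+ 3)); have := normr_ge0 (ln (Cst ^+ 2)).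
by split; lra.
Qed.

Definition grid_const : R := 2 * Rad + 1.
(** Twice the factor of [ellipsoid_cover]: recentring a covering ball at one of its points doubles
    the radius. *)
Definition radius_const : R := 2 * (d%:R * (Rad + 1) + 1).

Lemma grid_const_gt0 : 0 < grid_const.
Proof. by have := Rad0; rewrite /grid_const; lra. Qed.

Lemma radius_const_gt0 : 0 < radius_const.
Proof.
have R1 : 0 <= Rad + 1 by have := Rad0; lra.
have : 0 <= d%:R * (Rad + 1) by rewrite mulr_ge0.
by rewrite /radius_const; lra.
Qed.

Lemma cyl_nth (x : nat -> I) n : cyl x n (nth point (mkseq x n)).
Proof. by move=> l ln; rewrite nth_mkseq. Qed.

Lemma ae_ball_mass_cyl k (e : R) : (k < d)%N -> 0 < e ->
  {ae mu, forall w : Iseq I, exists n0, forall n, (n0 <= n)%N ->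
    expR (- (n%:R * e)) * mw mu (mkseq w n) /
      (grid_const ^+ k * phik w n k / alp w n k ^+ k) <=
    ball_mass mu proj (proj w) (radius_const * alp w n k)}.
Proof.
move=> kd e0; have kd' := ltnW kd.
(* Coverings have to depend on the word alone, so [u] is continued by the base point; its matrix
   product sees only the letters of [u]. *)
pose Mu (u : seq I) := wmx A (nth point u) (size u).
have MuE x n : Mu (mkseq x n) = wmx A x n.
  by rewrite /Mu size_mkseq; apply: wmx_cyl; exact: cyl_nth.
pose rho u := alp (nth point u) (size u) k.
have rhoE x n : rho (mkseq x n) = alp x n k by rewrite /rho /alp -/(Mu _) MuE.
have rho0 u : 0 < rho u by exact: alp_gt0.
pose N u := grid_const ^+ k * phik (nth point u) (size u) k / rho u ^+ k.
have NE x n : N (mkseq x n) = grid_const ^+ k * phik x n k / alp x n k ^+ k.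
  rewrite /N rhoE; congr (_ * _ / _); apply: eq_bigr => l _.
  by rewrite /alp -/(Mu _) MuE.
have N0 u : 0 < N u.
  by rewrite divr_gt0 ?exprn_gt0// mulr_gt0 ?phik_gt0// exprn_gt0// grid_const_gt0.
have HJ u : exists J : seq 'cV[R]_d, (size J)%:R <= N u /\ forall y, eucl y <= Rad ->
    exists2 q, q \in J & eucl (Mu u *m y + fw A a (nth point u) (size u) 0 - q) <
      (d%:R * (Rad + 1) + 1) * rho u.
  have Mun : Mu u \in unitmx by exact: wmx_unit.
  have [||J [J1 J2]] := ellipsoid_cover (Mu u) (svals (Mu u))
      (fw A a (nth point u) (size u) 0) Rad (rho u) k (svals_svd _ Mun) Rad0 (rho0 u).
  - by move=> l lk; rewrite -alphaE; apply: alpha_mono => //; exact: ltnW.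
  - by move=> l kl; rewrite -alphaE; exact: alpha_mono.
  exists J; split; last exact: J2.
  apply: (le_trans J1); rewrite le_eqVlt; apply/orP; left; apply/eqP.
  rewrite big_split /= /N -mulrA; congr (_ * _).
    rewrite (big_ord_narrow kd') prodr_const card_ord//.
  rewrite (big_ord_narrow kd') /= big_split /= prodr_const card_ord exprVn; congr (_ / _).
  by apply: eq_bigr => l _; rewrite -alphaE.
have [J HJ'] := choice HJ.
have HF n : exists F : set (Iseq I), [/\ measurable F,
    (mu F <= (expR (- (n%:R * e)))%:E)%E &
    forall x : nat -> I, ~ F x -> expR (- (n%:R * e)) * mw mu (mkseq x n) / N (mkseq x n) <=
       ball_mass mu proj (proj x) (2 * ((d%:R * (Rad + 1) + 1) * rho (mkseq x n)))].
  apply: (small_ball_exception hI mu proj proj_continuous n J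
    (fun u => (d%:R * (Rad + 1) + 1) * rho u) N) => //.
    by move=> x; have [] := HJ' (mkseq x n).
  move=> x; have [y [yR yE]] := piA_fw A a Rad c Rad0 (ltW c0) c1 Ac ARad x n.
  have [_ /(_ y yR)[q qJ Hq]] := HJ' (mkseq x n).
  exists q => //; move: Hq; rewrite MuE size_mkseq (fw_cyl A a x); last exact: cyl_nth.
  by rewrite -{1}[y]subr0 -(fw_sub A a) subrK /proj yE.
have [F HF'] := choice HF.
have := borel_cantelli_ae mu F (fun n => expR (- (n%:R * e))) (1 - expR (- e))^-1.
move=> /(_ _ _ _) BC; apply: filterS (BC _ _ _).
- move=> w [n0 Hn0]; exists n0 => n n0n.
  have [_ _ /(_ w (Hn0 n n0n))] := HF' n.
  by rewrite NE rhoE /radius_const mulrA.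
- by move=> n; have [] := HF' n.
- by move=> n; have [] := HF' n.
- by move=> m; exact: sum_expR_le.
Qed.

Lemma is_svd1 : is_svd (1%:M : 'M[R]_d) (const_mx 1).
Proof.
split; first by move=> k l _; rewrite !mxE.
split; first by move=> k; rewrite mxE.
exists 1%:M, 1%:M; do 2 (split; first by rewrite trmx1 mulmx1).
by rewrite trmx1 mulmx1 mul1mx diag_const_mx.
Qed.

Lemma ae_ball_mass_full (e : R) : 0 < e ->
  {ae mu, forall w : Iseq I, exists n0, forall n, (n0 <= n)%N ->
    expR (- (n%:R * e)) / (grid_const / expR (- n%:R)) ^+ d <=
    ball_mass mu proj (proj w) (radius_const * expR (- n%:R))}.
Proof.
move=> e0.
pose N n : R := (grid_const / expR (- n%:R)) ^+ d.
have N0 n : 0 < N n by rewrite exprn_gt0// divr_gt0 ?expR_gt0// grid_const_gt0.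
have HJ n : exists J : seq 'cV[R]_d, (size J)%:R <= N n /\ forall y, eucl y <= Rad ->
    exists2 q, q \in J & eucl (1%:M *m y + 0 - q) < (d%:R * (Rad + 1) + 1) * expR (- n%:R).
  have [||J [J1 J2]] := ellipsoid_cover 1%:M (const_mx 1) 0 Rad (expR (- n%:R)) d
      is_svd1 Rad0 (expR_gt0 _).
  - by move=> l _; rewrite mxE -expR0 ler_expR oppr_le0.
  - by move=> l; rewrite leqNgt ltn_ord.
  exists J; split; last exact: J2.
  apply: (le_trans J1); rewrite le_eqVlt; apply/orP; left; apply/eqP.
  rewrite (eq_bigl xpredT); last by move=> l; rewrite ltn_ord.
  under eq_bigr => l _ do rewrite mxE div1r.
  by rewrite prodr_const card_ord.
have [J HJ'] := choice HJ.
have HF n : exists F : set (Iseq I), [/\ measurable F,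
    (mu F <= (expR (- (n%:R * e)))%:E)%E &
    forall x : nat -> I, ~ F x -> expR (- (n%:R * e)) * mw mu (mkseq x 0) / N n <=
       ball_mass mu proj (proj x) (2 * ((d%:R * (Rad + 1) + 1) * expR (- n%:R)))].
  apply: (small_ball_exception hI mu proj proj_continuous 0 (fun=> J n)
    (fun=> (d%:R * (Rad + 1) + 1) * expR (- n%:R)) (fun=> N n)) => //.
    by move=> x; have [] := HJ' n.
  move=> x; have [y [yR /= E]] := piA_fw A a Rad c Rad0 (ltW c0) c1 Ac ARad x 0.
  have [_ /(_ y yR)[q qJ Hq]] := HJ' n.
  by exists q => //; move: Hq; rewrite mul1mx addr0 /proj E.
have [F HF'] := choice HF.
have := borel_cantelli_ae mu F (fun n => expR (- (n%:R * e))) (1 - expR (- e))^-1.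
move=> /(_ _ _ _) BC; apply: filterS (BC _ _ _).
- move=> w [n0 Hn0]; exists n0 => n n0n.
  have [_ _ /(_ w (Hn0 n n0n))] := HF' n.
  by rewrite mw_nil mulr1 /radius_const mulrA.
- by move=> n; have [] := HF' n.
- by move=> n; have [] := HF' n.
- by move=> m; exact: sum_expR_le.
Qed.

End Process.

(** * Limits of phi^s along one sequence *)

Section Pointwise.
Context {I : pointedType} {R : realType} {d : nat}.
Variables (A : I -> 'M[R]_d) (c : R).
Hypothesis Ainv : forall i, A i \in unitmx.
Hypotheses (c0 : 0 < c) (c1 : c < 1).
Hypothesis Ac : forall i v, eucl (A i *m v) <= c * eucl v.
Variables (w : nat -> I) (L : nat -> \bar R).
Hypothesis HL : forall k, (k <= d)%N ->
  (ln (phik A w n k) / n%:R)%:E @[n --> \oo] --> L k.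

Let al_gt0 n l := alp_gt0 A Ainv w n l.
Let al_le1 n l := alp_le1 A c Ainv c0 c1 Ac w n l.
Let ph_gt0 n k := phik_gt0 A Ainv w n k.
Let ph_le1 n k := phik_le1 A c Ainv c0 c1 Ac w n k.

Lemma L_le0 k : (k <= d)%N -> (L k <= 0)%E.
Proof.
move=> kd; have cv := HL k kd; rewrite -(cvg_lim _ cv)//.
apply: lime_le; first by apply/cvg_ex; eexists; exact: cv.
apply: nearW => n; rewrite lee_fin mulr_le0_ge0 ?invr_ge0//.
by rewrite ln_le0// ph_le1.
Qed.

Lemma phis_ltE n (s : R) : 0 <= s -> s < d%:R ->
  phis (wmx A w n) s =
  phik A w n (Num.truncn s) * powR (alp A w n (Num.truncn s)) (s - (Num.truncn s)%:R).
Proof. by move=> s0 sd; rewrite /phis sd. Qed.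

Lemma phis_geE n (s : R) : d%:R <= s ->
  phis (wmx A w n) s = powR (phik A w n d) (s / d%:R).
Proof. by move=> ds; rewrite /phis ltNge ds. Qed.

Lemma truncn_ltd (s : R) : 0 <= s -> s < d%:R -> (Num.truncn s < d)%N.
Proof. by move=> s0 sd; rewrite -(ltr_nat R); apply: le_lt_trans sd; rewrite truncn_le. Qed.

Lemma phis_gt0 n (s : R) : 0 <= s -> 0 < phis (wmx A w n) s.
Proof.
move=> s0; have [sd|ds] := ltP s d%:R.
  rewrite phis_ltE// mulr_gt0 ?powR_gt0 ?ph_gt0 ?al_gt0 ?truncn_ltd//.
  exact/ltnW/truncn_ltd.
by rewrite phis_geE// powR_gt0// ph_gt0.
Qed.

Lemma ln_alp n k : (k < d)%N -> ln (alp A w n k) = ln (phik A w n k.+1) - ln (phik A w n k).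
Proof.
move=> kd; rewrite phikS lnM ?posrE ?al_gt0 ?ph_gt0// 1?ltnW//.
by rewrite addrAC subrr add0r.
Qed.

Lemma ln_phis_lt n (s : R) : 0 <= s -> s < d%:R -> let k := Num.truncn s in
  ln (phis (wmx A w n) s) =
  (1 - (s - k%:R)) * ln (phik A w n k) + (s - k%:R) * ln (phik A w n k.+1).
Proof.
move=> s0 sd k; have kd : (k < d)%N by exact: truncn_ltd.
rewrite phis_ltE// lnM ?posrE ?powR_gt0 ?al_gt0 ?ph_gt0// 1?ltnW//.
by rewrite ln_powR ln_alp// -/k; ring.
Qed.

Lemma LamE (s : R) (l : \bar R) : 0 <= s ->
  (ln (phis (wmx A w n) s) / n%:R)%:E @[n --> \oo] --> l -> Lam A s w = l.
Proof.
move=> s0 cv; rewrite /Lam; apply: cvg_lim => //.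
rewrite (_ : (fun n => _) = (fun n => (ln (phis (wmx A w n) s) / n%:R)%:E))//.
by apply/funext => n; rewrite /elog gt_eqF ?phis_gt0// EFinM.
Qed.

Lemma phis_cvg_lt (s : R) : 0 <= s -> s < d%:R -> let k := Num.truncn s in
  (ln (phis (wmx A w n) s) / n%:R)%:E @[n --> \oo] -->
  ((1 - (s - k%:R))%:E * L k + (s - k%:R)%:E * L k.+1)%E.
Proof.
move=> s0 sd k; have kd : (k < d)%N by exact: truncn_ltd.
have /andP[ks sk] : k%:R <= s < k.+1%:R by exact: truncn_itv.
have t0 : 0 <= s - k%:R by rewrite subr_ge0.
have t1 : 0 <= 1 - (s - k%:R) by rewrite -[k.+1%:R]natr1 in sk; lra.
rewrite (_ : (fun n => _) = (fun n => ((1 - (s - k%:R))%:E * (ln (phik A w n k) / n%:R)%:E +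
   (s - k%:R)%:E * (ln (phik A w n k.+1) / n%:R)%:E)%E)); last first.
  by apply/funext => n; rewrite ln_phis_lt// -/k -!EFinM -EFinD; congr (_%:E); ring.
apply: cvgeD; last 2 first.
- by apply: cvgeZl => //; apply: HL; exact: ltnW.
- by apply: cvgeZl => //; exact: HL.
(* Both summands are at most 0, so the sum is never of the form +oo - oo. *)
have n0 (x : R) k' : 0 <= x -> (k' <= d)%N -> (x%:E * L k' <= 0)%E.
  by move=> x0 kd'; rewrite mule_ge0_le0 ?lee_fin// L_le0.
rewrite /adde_def; apply/andP; split.
  apply/negP => /andP[/eqP E _]; have := n0 _ k t1 (ltnW kd).
  by rewrite E.
apply/negP => /andP[_ /eqP E]; have := n0 _ k.+1 t0 kd.
by rewrite E.
Qed.

Lemma phis_cvg (s : R) : 0 <= s ->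
  exists l : \bar R, (ln (phis (wmx A w n) s) / n%:R)%:E @[n --> \oo] --> l.
Proof.
move=> s0; have [sd|ds] := ltP s d%:R; first by eexists; exact: phis_cvg_lt.
exists ((s / d%:R)%:E * L d)%E.
rewrite (_ : (fun n => _) = (fun n => ((s / d%:R)%:E * (ln (phik A w n d) / n%:R)%:E)%E)).
  by apply: cvgeZl => //; exact: HL.
by apply/funext => n; rewrite phis_geE// ln_powR -EFinM mulrA.
Qed.

(** Within [k, k+1) only the power of alpha_{k+1} <= 1 changes. Beyond it, alpha_1 ... alpha_{k+1}
    separates the two values; for s >= d the exponent s/d >= 1 acts on a number at most 1. *)
Lemma phis_mono n (s t : R) : 0 <= t -> t < d%:R -> t <= s ->
  phis (wmx A w n) s <= phis (wmx A w n) t.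
Proof.
move=> t0 td ts; have s0 := le_trans t0 ts.
have kd := truncn_ltd t t0 td; set k := Num.truncn t in kd *.
have /andP[kt tk] : k%:R <= t < k.+1%:R by exact: truncn_itv.
have a01 l : (l < d)%N -> 0 < alp A w n l <= 1 by move=> ld; rewrite al_gt0//= al_le1.
have pt : phik A w n k.+1 <= phis (wmx A w n) t.
  rewrite phis_ltE// -/k phikS ler_wpM2l ?(ltW (ph_gt0 _ _ _))// 1?ltnW//.
  rewrite -[X in X <= _]powRr1; last by rewrite ltW// al_gt0.
  rewrite ger_powR ?a01//.
  by rewrite -[k.+1%:R]natr1 in tk; lra.
have [sd|ds] := ltP s d%:R.
  have k's := truncn_ltd s s0 sd; set k' := Num.truncn s in k's.
  have kk' : (k <= k')%N by exact: le_truncn.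
  have /andP[ks sk] : k'%:R <= s < k'.+1%:R by exact: truncn_itv.
  have [ltkk'|] := ltnP k k'.
    apply: le_trans pt; rewrite phis_ltE// -/k'.
    apply: (@le_trans _ _ (phik A w n k')).
      rewrite ler_piMr ?(ltW (ph_gt0 n k' (ltnW k's)))//.
      have sk0 : 0 <= s - k'%:R by rewrite subr_ge0.
      by have := ger_powR (a01 k' k's) sk0; rewrite powRr0.
    by apply: (phik_mono A c Ainv c0 c1 Ac); rewrite ltkk' ltnW.
  move=> k'k; have E : k' = k by apply/eqP; rewrite eqn_leq k'k kk'.
  rewrite !phis_ltE// -/k -/k' E ler_wpM2l ?(ltW (ph_gt0 _ _ _))// 1?ltnW//.
  by rewrite ger_powR ?a01// lerD2r.
apply: le_trans pt; rewrite phis_geE//.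
have d0 : 0 < d%:R :> R by rewrite ltr0n (leq_ltn_trans _ kd).
apply: (@le_trans _ _ (phik A w n d)).
  rewrite -[leRHS]powRr1; last by rewrite ltW// ph_gt0.
  by rewrite ger_powR ?ph_gt0 ?ph_le1// ler_pdivlMr// mul1r.
by apply: (phik_mono A c Ainv c0 c1 Ac); rewrite kd leqnn.
Qed.

Lemma Lam_mono (s t : R) : 0 <= t -> t < d%:R -> t <= s -> (Lam A s w <= Lam A t w)%E.
Proof.
move=> t0 td ts; have s0 := le_trans t0 ts.
have [ls cs] := phis_cvg s s0; have [lt ct] := phis_cvg t t0.
rewrite (LamE s ls s0 cs) (LamE t lt t0 ct) -(cvg_lim _ cs)// -(cvg_lim _ ct)//.
apply: lee_lim.
- by apply/cvg_ex; eexists; exact: cs.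
- by apply/cvg_ex; eexists; exact: ct.
apply: nearW => n; rewrite lee_fin ler_wpM2r ?invr_ge0//.
by rewrite ler_ln ?posrE ?phis_gt0// phis_mono.
Qed.

Lemma Lam_lt (t : R) : 0 <= t -> t < d%:R -> let k := Num.truncn t in
  Lam A t w = ((1 - (t - k%:R))%:E * L k + (t - k%:R)%:E * L k.+1)%E.
Proof. by move=> t0 td k; apply: LamE => //; exact: phis_cvg_lt. Qed.

End Pointwise.

Lemma cvg_average_near {R : realType} (u : nat -> R) (l e : R) : 0 < e ->
  (u n / n%:R)%:E @[n --> \oo] --> l%:E ->
  exists n0, forall n, (n0 <= n)%N -> n%:R * (l - e) <= u n <= n%:R * (l + e).
Proof.
move=> e0 /fine_cvgP[_ /cvgrPdist_le/(_ e e0)[n0 _ H]].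
exists (maxn 1 n0) => n; rewrite geq_max => /andP[n1 n0n].
have := H n n0n; rewrite /= distrC ler_norml.
have n0' : 0 < n%:R :> R by rewrite ltr0n.
move=> /andP[]; rewrite lerBrDl ler_pdivlMr// => h1.
rewrite lerBlDl ler_pdivrMr// => h2.
by rewrite mulrC h1 /= mulrC.
Qed.

(** * From ball masses to local dimension at one point *)

Section PointwiseDimension.
Context {I : pointedType} {R : realType} {d : nat}.
Hypothesis hI : countable [set: I].
Variables (A : I -> 'M[R]_d) (a : I -> 'cV[R]_d) (Rad c : R).
Hypothesis Ainv : forall i, A i \in unitmx.
Hypotheses (Rad0 : 0 < Rad) (c0 : 0 < c) (c1 : c < 1).
Hypothesis Ac : forall i v, eucl (A i *m v) <= c * eucl v.
Hypothesis ARad : forall i x, eucl x <= Rad -> eucl (A i *m x + a i) <= Rad.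
Variable mu : probability (Iseq I) R.
Variable w : nat -> I.

Let proj := piA A a Rad.
Let proj_continuous := piA_continuous A a Rad c Rad0 (ltW c0) c1 Ac ARad.

Lemma updimloc_le_d :
  (forall m, exists n0, forall n, (n0 <= n)%N ->
    expR (- (n%:R * m.+1%:R^-1)) / (grid_const Rad / expR (- n%:R)) ^+ d <=
    ball_mass mu proj (proj w) (@radius_const R d Rad * expR (- n%:R))) ->
  (updimloc mu proj (proj w) <= (d%:R)%:E)%E.
Proof.
move=> H; apply/lee_addgt0Pr => e e0; rewrite -EFinD.
have [m em] : exists m, m.+1%:R^-1 <= e / 2.
  exists (Num.truncn (e / 2)^-1); rewrite invf_ple ?posrE ?divr_gt0//.
  exact/ltW/truncnS_gt.
have [n0 Hn0] := H m; set ep := m.+1%:R^-1 in em Hn0.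
have ep0 : 0 < ep by rewrite invr_gt0.
have g0 := grid_const_gt0 Rad Rad0.
pose lg := ln (grid_const Rad).
have -> : d%:R + e = (d%:R + e) / 1 by rewrite divr1.
apply: (updimloc_le hI mu proj proj_continuous (proj w) (@radius_const R d Rad) 1 (d%:R + e)
  (maxn n0 (Num.truncn (d%:R * `|lg| / ep)).+1)) => //.
- exact: radius_const_gt0.
- by rewrite addr_ge0// ltW.
move=> n; rewrite geq_max => /andP[n0n nb].
have nlg : d%:R * `|lg| <= n%:R * ep.
  rewrite -ler_pdivrMr//; apply: le_trans (ltW (truncnS_gt _)) _; by rewrite ler_nat.
rewrite mulr1; apply: le_trans (Hn0 n n0n).
rewrite -[grid_const Rad]lnK ?posrE// -/lg -expRN -expRD opprK -expRM_natr -expRN -expRD.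
rewrite ler_expR.
have : d%:R * lg <= d%:R * `|lg| by rewrite ler_wpM2l// ler_norm.
have : n%:R * ep <= n%:R * (e / 2) by rewrite ler_wpM2l.
lra.
Qed.

(** [ak] and [bk] are the growth rates of alpha_1 ... alpha_k and alpha_1 ... alpha_{k+1}, so bk -
    ak is the Lyapunov exponent lambda_{k+1}; for k <= t < k+1 and t < d, [Ht] says P_mu(t) <= 0. *)
Variables (k : nat) (ak bk h0 t : R).
Hypotheses (kd : (k < d)%N) (kt : k%:R <= t).
Hypothesis Hk : (ln (phik A w n k) / n%:R)%:E @[n --> \oo] --> ak%:E.
Hypothesis Hk1 : (ln (phik A w n k.+1) / n%:R)%:E @[n --> \oo] --> bk%:E.
Hypothesis Hmu : (- ln (mw mu (mkseq w n)) / n%:R)%:E @[n --> \oo] --> h0%:E.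
Hypothesis Hpos : forall n, 0 < mw mu (mkseq w n).
Hypothesis Hball : forall m, exists n0, forall n, (n0 <= n)%N ->
    expR (- (n%:R * m.+1%:R^-1)) * mw mu (mkseq w n) /
      (grid_const Rad ^+ k * phik A w n k / alp A w n k ^+ k) <=
    ball_mass mu proj (proj w) (@radius_const R d Rad * alp A w n k).
Hypothesis Ht : h0 + ak + (t - k%:R) * (bk - ak) <= 0.

Lemma exponent_lt0 : bk < ak.
Proof.
rewrite ltNge; apply/negP => ab.
have lc : ln c < 0 by rewrite ln_lt0// c0.
(* As alpha_{k+1} <= c^n, the two errors [e] still leave bk - ak <= (ln c) / 2 < 0. *)
pose e := - ln c / 4; have e0 : 0 < e by rewrite divr_gt0// oppr_gt0.
have [n1 H1] := cvg_average_near _ _ _ e0 Hk.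
have [n2 H2] := cvg_average_near _ _ _ e0 Hk1.
pose n := (maxn n1 n2).+1.
have /andP[_ h1] := H1 n (leqW (leq_maxl _ _)).
have /andP[h2 _] := H2 n (leqW (leq_maxr _ _)).
have : ln (alp A w n k) <= n%:R * ln c.
  rewrite mulr_natl -lnXn// ler_ln ?posrE ?exprn_gt0// ?(alp_gt0 A Ainv)//.
  exact: (alp_le A c Ainv c0 Ac).
rewrite (ln_alp A Ainv w)// => h3.
have n0 : 0 < n%:R :> R by rewrite ltr0n.
have : n%:R * (bk - e) - n%:R * (ak + e) <= n%:R * ln c by lra.
rewrite -mulrBr ler_pM2l// /e; lra.
Qed.

Lemma updimloc_le_t : (updimloc mu proj (proj w) <= t%:E)%E.
Proof.
apply/lee_addgt0Pr => eta eta0; rewrite -EFinD.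
pose x := ak - bk; have x0 : 0 < x by rewrite subr_gt0 exponent_lt0.
have t0 : 0 <= t by apply: le_trans kt.
have s0 : 0 < k%:R + 4 + t + eta by have : 0 <= k%:R :> R by []; lra.
(* The first bound is what kap / (x - ep) <= t + eta amounts to, for [kap] below; the second keeps x
   - ep positive. *)
pose bnd := Num.min (eta * x / (k%:R + 4 + t + eta)) (x / 2).
have bnd0 : 0 < bnd by rewrite lt_min divr_gt0 ?mulr_gt0// divr_gt0.
have [m em] : exists m, m.+1%:R^-1 <= bnd.
  exists (Num.truncn bnd^-1); rewrite invf_ple ?posrE//; exact/ltW/truncnS_gt.
have [n0 Hn0] := Hball m; set ep := m.+1%:R^-1 in em Hn0.
have ep0 : 0 < ep by rewrite invr_gt0.
move: em; rewrite le_min => /andP[em1 em2].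
rewrite ler_pdivlMr// in em1.
have e20 : 0 < ep / 2 by rewrite divr_gt0.
have [n1 H1] := cvg_average_near _ _ _ e20 Hk.
have [n2 H2] := cvg_average_near _ _ _ e20 Hk1.
have [n3 H3] := cvg_average_near _ _ _ ep0 Hmu.
have g0 := grid_const_gt0 Rad Rad0.
pose lg := ln (grid_const Rad).
(* Errors per step: one [ep] each from Borel-Cantelli, the entropy and the power of [grid_const],
   half of one from [phik], and [k] from alpha_{k+1}^k. *)
pose kap := t * x + (k%:R + 4) * ep.
have X0 : 0 < x - ep by lra.
have kap0 : 0 <= kap.
  by rewrite addr_ge0// mulr_ge0// ?(ltW x0)// ?(ltW ep0)// addr_ge0.
apply: (@le_trans _ _ (kap / (x - ep))%:E); last first.
  rewrite lee_fin ler_pdivrMr// /kap; lra.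
apply: (updimloc_le hI mu proj proj_continuous (proj w) (@radius_const R d Rad) (x - ep) kap
  (maxn (maxn n0 n1) (maxn (maxn n2 n3) (Num.truncn (k%:R * `|lg| / ep)).+1))) => //.
  exact: radius_const_gt0.
move=> n; rewrite !geq_max => /andP[/andP[n0n n1n] /andP[/andP[n2n n3n] nb]].
have nlg : k%:R * `|lg| <= n%:R * ep.
  rewrite -ler_pdivrMr//; apply: le_trans (ltW (truncnS_gt _)) _; by rewrite ler_nat.
have klg : k%:R * lg <= k%:R * `|lg| by rewrite ler_wpM2l// ler_norm.
have /andP[h1 h1'] := H1 n n1n; have /andP[h2 h2'] := H2 n n2n.
have /andP[_ h3] := H3 n n3n.
have al0 : 0 < alp A w n k by exact: alp_gt0.
have ph0 : 0 < phik A w n k by apply: phik_gt0 => //; exact: ltnW.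
have lal := ln_alp A Ainv w n k kd.
set la := ln (alp A w n k) in lal.
set lp := ln (phik A w n k) in lal h1 h1'.
set lp1 := ln (phik A w n k.+1) in lal h2 h2'.
set lm := ln (mw mu (mkseq w n)) in h3.
have la1 : la <= - (n%:R * (x - ep)) by rewrite lal /x; lra.
have la2 : - (n%:R * (x + ep)) <= la by rewrite lal /x; lra.
apply: (@le_trans _ _ (ball_mass mu proj (proj w) (@radius_const R d Rad * alp A w n k))); last first.
  apply: (ball_mass_le hI mu proj proj_continuous).
  rewrite ler_wpM2l ?(ltW (radius_const_gt0 _ Rad0))//.
  by rewrite -[alp A w n k]lnK ?posrE// ler_expR.
apply: le_trans (Hn0 n n0n).
rewrite -[mw mu (mkseq w n)]lnK ?posrE// -/lm -[grid_const Rad]lnK ?posrE// -/lg.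
rewrite -[phik A w n k]lnK ?posrE// -/lp -[alp A w n k]lnK ?posrE// -/la.
rewrite -!expRM_natr -!expRN -!expRD -expRN -expRD ler_expR.
have nn : 0 <= n%:R :> R by [].
have k0 : 0 <= k%:R :> R by [].
have kla : - (k%:R * (n%:R * (x + ep))) <= la * k%:R.
  by rewrite mulrC -mulNr ler_wpM2r.
(* Here P_mu(t) <= 0 enters: adding k x, which comes from alpha_{k+1}^{-k}, turns (t - k) x into t
   x. *)
have hx : n%:R * (h0 + ak) <= n%:R * ((t - k%:R) * x).
  rewrite ler_wpM2l// /x; have := Ht; lra.
have epn : 0 <= n%:R * ep by rewrite mulr_ge0// ltW.
rewrite /kap; nra.
Qed.

End PointwiseDimension.

(** * Choice of the exponent t and conclusion *)

Theorem mainTheorem3 (R : realType) (I : pointedType)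
  (hI : countable [set: I]) (d : nat) (hd : (0 < d)%N)
  (A : I -> 'M[R]_d) (hAinv : forall i, A i \in unitmx)
  (hAcontr : exists c : R, c < 1 /\ forall i, opnorm (A i) <= c)
  (mu : probability (Iseq I) R)
  (hinv : forall E : set (Iseq I), measurable E -> mu (@sshift I @^-1` E) = mu E)
  (hent : (hmu mu < +oo)%E) :
  forall a : I -> 'cV[R]_d,
    (forall i (k : 'I_d), - (1 / 2) <= a i k ord0 <= 1 / 2) ->
  forall Rad : R, 0 < Rad ->
    (forall i (x : 'cV[R]_d), eucl x <= Rad -> eucl (A i *m x + a i) <= Rad) ->
  {ae mu, forall w : Iseq I,
     (exists s : R, (dimLY A mu w < s%:E)%E /\ (-oo < Lam A s w)%E) ->
     (updimloc mu (piA A a Rad) (piA A a Rad w)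
        <= Order.min (d%:R)%:E (dimLY A mu w))%E}.
Proof.
move=> a _ Rad Rad0 ARad.
have [c [c0 c1 Ac]] : exists c : R, [/\ 0 < c, c < 1 &
    forall i v, eucl (A i *m v) <= c * eucl v].
  (* The maximum with 1/2 makes the contraction rate positive, so that [ln c] can be used. *)
  have [c [c1 Hc]] := hAcontr; exists (Num.max c (1 / 2)); split.
  - by rewrite lt_max; apply/orP; right; lra.
  - by rewrite gt_max c1/=; lra.
  move=> i v; apply: le_trans (eucl_mulmx_le _ _ _) _.
  by rewrite ler_wpM2r ?eucl_ge0// le_max Hc.
have smb := shannon_mcmillan_breiman hI mu hinv hent.
have lyap : {ae mu, forall w : Iseq I, forall k, (k <= d)%N -> exists l : \bar R,
    (ln (phik A w n k) / n%:R)%:E @[n --> \oo] --> l}.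
  apply: ae_foralln => k; have [kd|kd] := leqP k d; last first.
    by apply: aeW => w.
  by apply: filterS (ae_lim_phik hI A c hAinv c0 c1 Ac mu hinv k kd) => w Hw _.
have ep0 m : 0 < m.+1%:R^-1 :> R by rewrite invr_gt0.
have full : {ae mu, forall w : Iseq I, forall m, exists n0, forall n, (n0 <= n)%N ->
    expR (- (n%:R * m.+1%:R^-1)) / (grid_const Rad / expR (- n%:R)) ^+ d <=
    ball_mass mu (piA A a Rad) (piA A a Rad w) (@radius_const R d Rad * expR (- n%:R))}.
  apply: ae_foralln => m.
  exact: (ae_ball_mass_full hI A a Rad c Rad0 c0 c1 Ac ARad mu _ (ep0 m)).
have ball : {ae mu, forall w : Iseq I, forall k, (k < d)%N -> forall m, exists n0,
    forall n, (n0 <= n)%N ->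
    expR (- (n%:R * m.+1%:R^-1)) * mw mu (mkseq w n) /
      (grid_const Rad ^+ k * phik A w n k / alp A w n k ^+ k) <=
    ball_mass mu (piA A a Rad) (piA A a Rad w) (@radius_const R d Rad * alp A w n k)}.
  apply: ae_foralln => k; have [kd|kd] := ltnP k d; last first.
    by apply: aeW => w.
  suff : {ae mu, forall w : Iseq I, forall m, exists n0, forall n, (n0 <= n)%N ->
      expR (- (n%:R * m.+1%:R^-1)) * mw mu (mkseq w n) /
        (grid_const Rad ^+ k * phik A w n k / alp A w n k ^+ k) <=
      ball_mass mu (piA A a Rad) (piA A a Rad w) (@radius_const R d Rad * alp A w n k)}.
    by apply: filterS => w Hw _.
  apply: ae_foralln => m.
  exact: (ae_ball_mass_cyl hI A a Rad c hAinv Rad0 c0 c1 Ac ARad mu k _ kd (ep0 m)).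
apply: filterS2 (filterI smb lyap) (filterI full ball).
move=> w [[wpos [h hcv]] lyapw] [fullw ballw] [s [Ds Lams]].
have le_d := updimloc_le_d hI A a Rad c Rad0 c0 c1 Ac ARad mu w fullw.
have HL : exists L : nat -> \bar R, forall k, (k <= d)%N ->
    (ln (phik A w n k) / n%:R)%:E @[n --> \oo] --> L k.
  have /choice[L HL] : forall k, exists l : \bar R, (k <= d)%N ->
      (ln (phik A w n k) / n%:R)%:E @[n --> \oo] --> l.
    move=> k; have [kd|kd] := leqP k d; last by exists 0%E.
    by have [l Hl] := lyapw k kd; exists l.
  by exists L.
have {HL}[L HL] := HL.
rewrite le_min le_d /=.
have [dD|Dd] := leP (d%:R)%:E (dimLY A mu w); first exact: le_trans dD.
have hlocE : hloc mu w = h.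
  rewrite /hloc; apply: cvg_lim => //.
  rewrite (_ : (fun n => _) = (fun n => (- ln (mw mu (mkseq w n)) / n%:R)%:E))//.
  apply/funext => n; rewrite cyl_cylseq -/(mw mu _) /elog gt_eqF ?wpos//.
have D0 : (0 <= dimLY A mu w)%E.
  by apply: le_ereal_inf_tmp => _ [r [r0 _] <-]; rewrite lee_fin.
have [D DE] : exists D : R, dimLY A mu w = D%:E.
  by move: D0 Dd; case: (dimLY A mu w) => // D _ _; exists D.
rewrite DE; apply/lee_addgt0Pr => e e0; rewrite -EFinD.
rewrite DE !lte_fin in Ds Dd.
have : (dimLY A mu w < (Num.min (D + e) (Num.min s d%:R))%:E)%E.
  by rewrite DE lte_fin !lt_min ltrDl e0 Ds Dd.
move=> /ereal_inf_lt[_ [t0 [t00 Pt0] <-]]; rewrite lte_fin !lt_min => /and3P[tD ts td].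
pose k := Num.truncn t0.
have kd : (k < d)%N by rewrite -(ltr_nat R); apply: le_lt_trans td; rewrite truncn_le.
have /andP[kt tk] : k%:R <= t0 < k.+1%:R by exact: truncn_itv.
(* Moving from t0 to t > t0 below [top] makes t strictly larger than k and keeps it below k+1, d, s
   and D + e. *)
pose top := Num.min (Num.min (D + e) s) (Num.min d%:R k.+1%:R).
have ttop : t0 < top by rewrite !lt_min tD ts td tk.
pose t := (t0 + top) / 2.
have t0t : t0 < t by rewrite /t; lra.
have : t < top by rewrite /t; lra.
rewrite !lt_min => /andP[/andP[tDe tls] /andP[tld tk1]].
have t_0 : 0 <= t by rewrite (le_trans t00)// ltW.
have ktr : Num.truncn t = k.
  by apply/truncn_def; rewrite tk1 andbT (le_trans kt)// ltW.
have mono := Lam_mono A c hAinv c0 c1 Ac w L HL.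
have Lt := Lam_lt A c hAinv c0 c1 Ac w L HL t t_0 tld.
rewrite ktr /= in Lt.
have Lt_gt : (-oo < Lam A t w)%E by apply: lt_le_trans Lams _; apply: mono => //; exact: ltW.
have Lt_le : (Lam A t w <= Lam A t0 w)%E by apply: mono => //; exact: ltW.
have Lk0 := L_le0 A c hAinv c0 c1 Ac w L HL k (ltnW kd).
have Lk10 := L_le0 A c hAinv c0 c1 Ac w L HL k.+1 kd.
have th0 : 0 < t - k%:R by rewrite subr_gt0 (le_lt_trans kt).
have th1 : 0 < 1 - (t - k%:R) by move: tk1; rewrite -[k.+1%:R]natr1; lra.
(* The coefficient 1 - (t - k) is strictly positive, so an infinite [L k] would make Lambda_mu(t)
   equal to -oo, although it is at least Lambda_mu(s). *)
have [ak akE] : exists ak : R, L k = ak%:E.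
  move: Lk0 Lt; case: (L k) => [r _ _|//|_ Lt]; first by exists r.
  by move: Lt_gt; rewrite Lt gt0_muleNy ?lte_fin// addNye ltxx.
have [bk bkE] : exists bk : R, L k.+1 = bk%:E.
  move: Lk10 Lt; case: (L k.+1) => [r _ _|//|_ Lt]; first by exists r.
  by move: Lt_gt; rewrite Lt gt0_muleNy ?lte_fin// addeNy ltxx.
move: Pt0; rewrite /Pmu hlocE => Pt0.
have h_ge0 : (0 <= h)%E.
  rewrite -(cvg_lim _ hcv)//; apply: lime_ge; first by apply/cvg_ex; eexists; exact: hcv.
  apply: nearW => n; rewrite lee_fin divr_ge0// oppr_ge0 ln_le0//.
  exact: mw_le1.
have LtE : Lam A t w = ((1 - (t - k%:R)) * ak + (t - k%:R) * bk)%:E.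
  by rewrite Lt akE bkE -!EFinM -EFinD.
have Pt : (h + Lam A t w < 0)%E by apply: le_lt_trans Pt0; exact: leeD2l.
(* With Lambda_mu(t) finite, P_mu(t) < 0 excludes infinite local entropy. *)
have [h0 h0E] : exists h0 : R, h = h0%:E.
  move: h_ge0 Pt; rewrite LtE; case: h {hcv hlocE Pt0} => [r _ _|_ //|//]; by exists r.
apply: (@le_trans _ _ t%:E); last by rewrite lee_fin ltW.
apply: (updimloc_le_t hI A a Rad c hAinv Rad0 c0 c1 Ac ARad mu w k ak bk h0 t) => //.
- by rewrite ltW// -subr_gt0.
- by rewrite -akE; apply: HL; exact: ltnW.
- by rewrite -bkE; exact: HL.
- by rewrite -h0E.
- exact: ballw.
move: Pt; rewrite LtE h0E -EFinD lte_fin; lra.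
Qed.
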